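(* In the full propagation setting, a polynomial-time algorithm finds the best adaptive spreading strategy for a society with a constant number of types.
   Context: Full propagation setting. A society consists of $n$ areas; each area $v$ has a threshold $c_v\in\mathbb{Z}_{>0}$ and an initial acceptance probability $p_v\in[0,1]$. The areas are classified into types, and areas of the same type have the same threshold and the same initial acceptance probability. Areas are scheduled one at a time, each exactly once. When area $v$ is scheduled it makes an irrevocable decision in $\{1,-1\}$ ($1$ = accept, $-1$ = reject): let $I$ be the sum of the decisions of all previously scheduled areas ($I=0$ at the start); if $I\ge c_v$ then $v$ accepts; if $I\le -c_v$ then $v$ rejects; if $|I|<c_v$ then, independently of the past, $v$ accepts with probability $p_v$ and rejects with probability $1-p_v$. The number of adopters is the number of areas that accept. In an adaptive spreading strategy the planner sees the decisions of all areas scheduled so far before choosing which area to schedule next. A best adaptive spreading strategy is one that maximizes the expected number of adopters among all adaptive spreading strategies. *)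

(* Defs.v *)
From HB Require Import structures.
From mathcomp Require Import all_boot all_order all_algebra.

Set Implicit Arguments.
Unset Strict Implicit.
Unset Printing Implicit Defensive.

Import Order.TTheory GRing.Theory Num.Theory.
Local Open Scope ring_scope.

(* A society of [n] areas classified into (at most) [k] types.  Acceptance
   probabilities are rational because a society is the input of an algorithm. *)
Record society (k n : nat) := Society {
  kind : 'I_n -> 'I_k;
  threshold : 'I_n -> nat;
  prob : 'I_n -> rat;
  threshold_gt0 : forall v, (0 < threshold v)%N;
  prob_ge0 : forall v, 0 <= prob v;
  prob_le1 : forall v, prob v <= 1;
  kind_threshold : forall u v, kind u = kind v -> threshold u = threshold v;
  kind_prob : forall u v, kind u = kind v -> prob u = prob v
}.

(* Decisions are booleans: [true] stands for 1 (accept), [false] for -1. *)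
Definition influence (h : seq bool) : int :=
  \sum_(d <- h) (if d then 1 else -1).

Definition accept_prob (k n : nat) (S : society k n) (v : 'I_n) (I : int) : rat :=
  if (threshold S v)%:Z <= I then 1
  else if I <= - (threshold S v)%:Z then 0
  else prob S v.

Definition decision_prob (k n : nat) (S : society k n)
    (v : 'I_n) (I : int) (d : bool) : rat :=
  if d then accept_prob S v I else 1 - accept_prob S v I.

(* [sigma i h] is the area scheduled at step [i] (counting from 0) when the
   decisions observed so far are, in chronological order, [h]; only the values
   with [size h = i] matter.  The areas scheduled earlier need not be recorded
   in [h], since [sigma] and the prefixes of [h] determine them.  The step is an
   argument, although it equals [size h], so that the type is also inhabited for
   [n = 0]. *)
Definition strategy (n : nat) := 'I_n -> seq bool -> 'I_n.

(* Along every sequence of decisions, each area is scheduled exactly once. *)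
Definition valid (n : nat) (sigma : strategy n) : Prop :=
  forall w : n.-tuple bool, injective (fun i : 'I_n => sigma i (take i w)).

(* The probability that the successive decisions are [w]. *)
Definition outcome_prob (k n : nat) (S : society k n) (sigma : strategy n)
    (w : n.-tuple bool) : rat :=
  \prod_(i < n)
    decision_prob S (sigma i (take i w)) (influence (take i w)) (tnth w i).

Definition expected_adopters (k n : nat) (S : society k n)
    (sigma : strategy n) : rat :=
  \sum_(w : n.-tuple bool) outcome_prob S sigma w * (count id w)%:R.

Definition best (k n : nat) (S : society k n) (sigma : strategy n) : Prop :=
  valid sigma /\
  forall tau : strategy n, valid tau ->
    expected_adopters S tau <= expected_adopters S sigma.

Local Open Scope nat_scope.

(* Length of the binary representation, with [bits 0 = 1]. *)
Definition bits (m : nat) : nat := (trunc_log 2 m).+1.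

(* A machine has registers, which programs address by constants, and a random
   access memory; both hold natural numbers of arbitrary size. *)
Record state := State { regs : nat -> nat; mem : nat -> nat }.

Variant binop := Add | Sub | Mul | Div | Mod | Lt | Eq.

(* [Sub] is truncated, [Div] and [Mod] by 0 return 0 and the dividend. *)
Definition binop_sem (o : binop) (x y : nat) : nat :=
  match o with
  | Add => x + y
  | Sub => x - y
  | Mul => x * y
  | Div => x %/ y
  | Mod => x %% y
  | Lt => x < y
  | Eq => x == y
  end.

Inductive expr :=
| Cst of nat
| Reg of nat
| Read of expr
| Bin of binop & expr & expr.

Fixpoint eval (s : state) (e : expr) : nat :=
  match e with
  | Cst m => m
  | Reg x => regs s x
  | Read e1 => mem s (eval s e1)
  | Bin o e1 e2 => binop_sem o (eval s e1) (eval s e2)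
  end.

(* Logarithmic cost: the total number of bits of all values occurring in the
   evaluation, operands, addresses and results included.  Hence unbounded
   arithmetic does not exceed the power of polynomial-time Turing machines. *)
Fixpoint eval_cost (s : state) (e : expr) : nat :=
  bits (eval s e) +
  match e with
  | Cst _ | Reg _ => 0
  | Read e1 => eval_cost s e1
  | Bin _ e1 e2 => eval_cost s e1 + eval_cost s e2
  end.

Inductive program :=
| Skip
| Assign of nat & expr
| Store of expr & expr
| Seq of program & program
| If of expr & program & program
| While of expr & program.

(* [exec P s s' t]: started in [s], the program [P] halts in [s'] after time
   [t].  Tests succeed on nonzero values. *)
Inductive exec : program -> state -> state -> nat -> Prop :=
| ExecSkip s : exec Skip s s 1
| ExecAssign s x e :
    exec (Assign x e) s
      (State [eta regs s with x |-> eval s e] (mem s))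
      (eval_cost s e)
| ExecStore s ea e :
    exec (Store ea e) s
      (State (regs s) [eta mem s with eval s ea |-> eval s e])
      (eval_cost s ea + eval_cost s e)
| ExecSeq P Q s1 s2 s3 t1 t2 :
    exec P s1 s2 t1 -> exec Q s2 s3 t2 -> exec (Seq P Q) s1 s3 (t1 + t2)
| ExecIfTrue e P Q s s' t :
    eval s e != 0 -> exec P s s' t -> exec (If e P Q) s s' (eval_cost s e + t)
| ExecIfFalse e P Q s s' t :
    eval s e = 0 -> exec Q s s' t -> exec (If e P Q) s s' (eval_cost s e + t)
| ExecWhileTrue e P s1 s2 s3 t1 t2 :
    eval s1 e != 0 -> exec P s1 s2 t1 -> exec (While e P) s2 s3 t2 ->
    exec (While e P) s1 s3 (eval_cost s1 e + t1 + t2)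
| ExecWhileFalse e P s :
    eval s e = 0 -> exec (While e P) s s (eval_cost s e).

(* The input words occupy the memory from address 0 on; all the rest is 0. *)
Definition init (input : seq nat) : state := State (fun=> 0) (nth 0 input).

Definition input_size (input : seq nat) : nat := \sum_(x <- input) bits x.

(* The number of areas, followed by the type, the threshold, and the numerator
   and denominator in lowest terms of the probability of each area. *)
Definition encode (k n : nat) (S : society k n) : seq nat :=
  n :: flatten [seq [:: val (kind S v); threshold S v;
                        absz (numq (prob S v)); absz (denq (prob S v))]
               | v <- enum 'I_n].

(* A decision tree would have exponential size, so a strategy is output as a
   decision diagram, i.e., a decision tree with shared subtrees, linked in
   memory.  A node at address [a] consists of the area to be scheduled
   (at [a]) and of the addresses of the nodes to be visited next, after an
   acceptance (at [a + 1]) and after a rejection (at [a + 2]).  Register 0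
   holds the address of the root. *)
Definition node_after (s : state) (h : seq bool) : nat :=
  foldl (fun a d => mem s (a + (if d then 1 else 2))) (regs s 0) h.

Definition outputs (n : nat) (s : state) (sigma : strategy n) : Prop :=
  forall (i : 'I_n) (h : seq bool), size h = i ->
    sigma i h = mem s (node_after s h) :> nat.

(* Main.v *)
Require Import Defs.
From HB Require Import structures.
From mathcomp Require Import all_boot all_order all_algebra.
From mathcomp Require Import zify ring.
(* Otherwise [mem] would be that of ssrbool. *)
Import Defs.

Set Implicit Arguments.
Unset Strict Implicit.
Unset Printing Implicit Defensive.

(** Whether an area accepts depends only on its type and on the influence, so
    the best continuation depends only on the numbers [m j] of areas of each type
    [j] that remain and on the influence: for [k] types these are polynomially
    many situations, and backward induction over them gives an optimal choice in
    each.  To stay within the natural numbers, the influence [I] is stored as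
    [x = n + I], which at the end is twice the number of adopters, and the
    expected value is multiplied by the product of the [q j ^ m j], where [q j]
    is the common denominator of type [j].  The scaled value [W] then satisfies
    [W m x = max_j (a j * W (m - e_j) (x + 1) + (q j - a j) * W (m - e_j) (x - 1))],
    the maximum being over the [j] such that [m j > 0], with [a j / q j] the
    acceptance probability, and the number of its bits is polynomial.

    The situation [(m, x)] is the number with digits [x], [m 0], ..., [m (k - 1)]
    in base [2 * n + 1]; scheduling an area of type [j] subtracts
    [(2 * n + 1) ^ (j + 1)] from it and then adds or subtracts 1, so the nodes of
    the diagram are computed in increasing order. *)

(** * Cost of loop-free programs and of loops *)

Lemma bits_leq (m t : nat) : (0 < t -> m < 2 ^ t -> bits m <= t)%N.
Proof.
move=> t0 mt; rewrite /bits; case: m mt => [|m] mt; first by rewrite trunc_log0.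
rewrite -(ltn_exp2l _ _ (isT : 1 < 2)); apply: leq_ltn_trans mt.
exact: trunc_logP.
Qed.

Lemma ltn_exp_bits (m : nat) : (m < 2 ^ bits m)%N.
Proof. exact: trunc_log_ltn. Qed.

(** A factor: if all values in the state have at most [B] bits, the value of [e] has at most
    [esize e * B]. Bounds linear in [B] compose along a program. *)
Fixpoint esize (e : expr) : nat :=
  match e with
  | Cst m => bits m
  | Reg _ => 1
  | Read e1 => (esize e1).+1
  | Bin _ e1 e2 => (esize e1 + esize e2).+1
  end.

Fixpoint ecost (e : expr) : nat :=
  esize e +
  match e with
  | Cst _ | Reg _ => 0
  | Read e1 => ecost e1
  | Bin _ e1 e2 => ecost e1 + ecost e2
  end.

Definition bounded (B : nat) (s : state) : Prop :=
  (forall x, regs s x < 2 ^ B)%N /\ (forall a, mem s a < 2 ^ B)%N.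

Lemma bounded_leq (B B' : nat) s : B <= B' -> bounded B s -> bounded B' s.
Proof.
move=> le_B [rB mB]; have le2 : 2 ^ B <= 2 ^ B' by rewrite leq_exp2l.
by split=> x; apply: leq_trans le2.
Qed.

Lemma esize_gt0 e : 0 < esize e.
Proof. by case: e. Qed.

(** Operands of [u1] and [u2] bits give a result of at most [u1 + u2 + 1] bits; as [B] is positive,
    the successor in [esize] leaves room for the extra bit. *)
Lemma eval_ltn (B : nat) (s : state) (e : expr) :
  0 < B -> bounded B s -> eval s e < 2 ^ (esize e * B).
Proof.
move=> B_gt0 [rB mB]; elim: e => [m|x|e1 _|o e1 IH1 e2 IH2] /=.
- apply: leq_trans (ltn_exp_bits m) _.
  by rewrite leq_exp2l // leq_pmulr.
- by rewrite mul1n.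
- by apply: leq_trans (mB _) _; rewrite leq_exp2l // leq_pmull.
have size1 := esize_gt0 e1; have size2 := esize_gt0 e2.
set v1 := eval s e1 in IH1 *; set v2 := eval s e2 in IH2 *.
set u1 := esize e1 * B in IH1; set u2 := esize e2 * B in IH2.
have le1 : 2 ^ u1 <= 2 ^ (u1 + u2) by rewrite leq_exp2l // leq_addr.
have big : 2 ^ (u1 + u2).+1 <= 2 ^ ((esize e1 + esize e2).+1 * B).
  by rewrite leq_exp2l // mulSn mulnDl -/u1 -/u2; lia.
apply: leq_trans big; rewrite expnS.
have pos : 0 < 2 ^ (u1 + u2) by rewrite expn_gt0.
case: o => /=.
- have le2 : 2 ^ u2 <= 2 ^ (u1 + u2) by rewrite leq_exp2l // leq_addl.
  lia.
- lia.
- have : v1 * v2 < 2 ^ (u1 + u2).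
    by rewrite expnD; apply: ltn_mul.
  lia.
- by have := leq_div v1 v2; lia.
- by have := leq_mod v1 v2; lia.
- by case: (v1 < v2); lia.
- by case: (v1 == v2); lia.
Qed.

Lemma eval_cost_leq (B : nat) (s : state) (e : expr) :
  0 < B -> bounded B s -> eval_cost s e <= ecost e * B.
Proof.
move=> B_gt0 sB.
have bitsB e' : bits (eval s e') <= esize e' * B.
  by apply: bits_leq (eval_ltn e' B_gt0 sB); rewrite muln_gt0 esize_gt0.
elim: e => [m|x|e1 IH1|o e1 IH1 e2 IH2] /=; rewrite mulnDl.
- exact: leq_add (bitsB (Cst m)) _.
- exact: leq_add (bitsB (Reg x)) _.
- exact: leq_add (bitsB (Read e1)) IH1.
by apply: leq_add (bitsB (Bin o e1 e2)) _; rewrite mulnDl leq_add.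
Qed.

Fixpoint loop_free (P : program) : bool :=
  match P with
  | While _ _ => false
  | Seq P1 P2 | If _ P1 P2 => loop_free P1 && loop_free P2
  | _ => true
  end.

(* Loops are skipped: [run] is only meant for loop-free programs. *)
Fixpoint run (P : program) (s : state) : state :=
  match P with
  | Assign x e => State [eta regs s with x |-> eval s e] (mem s)
  | Store ea e => State (regs s) [eta mem s with eval s ea |-> eval s e]
  | Seq P1 P2 => run P2 (run P1 s)
  | If e P1 P2 => if eval s e != 0 then run P1 s else run P2 s
  | Skip | While _ _ => s
  end.

(* If all values in a state have at most [B] bits, then running [P] from it
   takes time at most [pcost P * B], and then all values have at most
   [growth P * B] bits. *)
Fixpoint growth (P : program) : nat :=
  match P with
  | Assign _ e => (esize e).+1
  | Store _ e => (esize e).+1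
  | Seq P1 P2 => growth P1 * growth P2
  | If _ P1 P2 => growth P1 + growth P2
  | Skip | While _ _ => 1
  end.

Fixpoint pcost (P : program) : nat :=
  match P with
  | Assign _ e => ecost e
  | Store ea e => ecost ea + ecost e
  | Seq P1 P2 => pcost P1 + pcost P2 * growth P1
  | If e P1 P2 => ecost e + (pcost P1 + pcost P2)
  | Skip | While _ _ => 1
  end.

Lemma growth_gt0 P : 0 < growth P.
Proof. by elim: P => //= *; lia. Qed.

Lemma exec_run (P : program) (B : nat) (s : state) :
    loop_free P -> 0 < B -> bounded B s ->
  bounded (growth P * B) (run P s) /\
  exists2 t, exec P s (run P s) t & t <= pcost P * B.
Proof.
elim: P B s => [|x e|ea e|P1 IH1 P2 IH2|e P1 IH1 P2 IH2|//] B s /=.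
- move=> _ B_gt0 sB; rewrite !mul1n; split=> //.
  by exists 1 => //; exact: ExecSkip.
- move=> _ B_gt0 sB; split; last first.
    by exists (eval_cost s e); [exact: ExecAssign | exact: eval_cost_leq].
  have [rB mB] : bounded ((esize e).+1 * B) s.
    by apply: bounded_leq sB; rewrite leq_pmull.
  split=> // y /=; case: eqP => // _.
  by apply: leq_trans (eval_ltn e B_gt0 sB) _; rewrite leq_exp2l // leq_mul.
- move=> _ B_gt0 sB; split; last first.
    exists (eval_cost s ea + eval_cost s e); first exact: ExecStore.
    by rewrite mulnDl leq_add ?eval_cost_leq.
  have [rB mB] : bounded ((esize e).+1 * B) s.
    by apply: bounded_leq sB; rewrite leq_pmull.
  split=> // y /=; case: eqP => // _.
  by apply: leq_trans (eval_ltn e B_gt0 sB) _; rewrite leq_exp2l // leq_mul.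
- case/andP=> lf1 lf2 B_gt0 sB.
  have [s1B [t1 ex1 le1]] := IH1 B s lf1 B_gt0 sB.
  have g0 : 0 < growth P1 * B by rewrite muln_gt0 growth_gt0.
  have [s2B [t2 ex2 le2]] := IH2 _ _ lf2 g0 s1B.
  split; first by rewrite (mulnC (growth P1)) -mulnA.
  exists (t1 + t2); first exact: ExecSeq ex1 ex2.
  by rewrite mulnDl -mulnA leq_add.
case/andP=> lf1 lf2 B_gt0 sB.
have costB := eval_cost_leq e B_gt0 sB.
have [s1B [t1 ex1 le1]] := IH1 B s lf1 B_gt0 sB.
have [s2B [t2 ex2 le2]] := IH2 B s lf2 B_gt0 sB.
case: ifPn => [e1|/negPn/eqP e0]; split.
- by apply: bounded_leq s1B; rewrite leq_mul // leq_addr.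
- by exists (eval_cost s e + t1); [exact: ExecIfTrue | rewrite !mulnDl; lia].
- by apply: bounded_leq s2B; rewrite leq_mul // leq_addl.
- by exists (eval_cost s e + t2); [exact: ExecIfFalse | rewrite !mulnDl; lia].
Qed.

Fixpoint writes (P : program) : seq nat :=
  match P with
  | Assign x _ => [:: x]
  | Seq P1 P2 | If _ P1 P2 => writes P1 ++ writes P2
  | _ => [::]
  end.

Fixpoint storeless (P : program) : bool :=
  match P with
  | Store _ _ => false
  | Seq P1 P2 | If _ P1 P2 => storeless P1 && storeless P2
  | _ => true
  end.

Lemma run_regs (P : program) (s : state) (x : nat) :
  x \notin writes P -> regs (run P s) x = regs s x.
Proof.
elim: P s => //= [y e|P1 IH1 P2 IH2|e P1 IH1 P2 IH2] s.
- by rewrite inE => /negPf ->.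
- by rewrite mem_cat => /norP[w1 w2]; rewrite IH2 // IH1.
by rewrite mem_cat => /norP[w1 w2]; case: ifP => _; [apply: IH1 | apply: IH2].
Qed.

Lemma run_mem (P : program) (s : state) : storeless P -> mem (run P s) = mem s.
Proof.
elim: P s => //= [P1 IH1 P2 IH2|e P1 IH1 P2 IH2] s /andP[w1 w2].
  by rewrite IH2 // IH1.
by case: ifP => _; [apply: IH1 | apply: IH2].
Qed.

(** Passes over the [k] types are unrolled, which is possible because [k] is fixed before the input
    is given; the bodies of the two genuine loops thus remain loop-free. *)
Fixpoint repeat (m : nat) (P : program) : program :=
  if m is m'.+1 then Seq P (repeat m' P) else Skip.

Lemma repeat_loop_free m P : loop_free P -> loop_free (repeat m P).
Proof. by move=> lfP; elim: m => //= m ->; rewrite lfP. Qed.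

Lemma repeat_writes m P x : x \notin writes P -> x \notin writes (repeat m P).
Proof. by move=> xP; elim: m => //= m IH; rewrite mem_cat negb_or xP. Qed.

Lemma run_seq P Q s : run (Seq P Q) s = run Q (run P s).
Proof. by []. Qed.

Lemma run_repeat m P s : run (repeat m P) s = iter m (run P) s.
Proof. by elim: m s => //= m IH s; rewrite IH -iterSr. Qed.

(** Iterating [exec_run] alone would multiply the bit length by [growth P] in each round. Here the
    invariant itself bounds all values by the same [B], so every round has the same cost bound. The
    induction is on the number of rounds left. *)
Lemma exec_while (e : expr) (P : program) (Inv : nat -> state -> Prop) (m B : nat) :
    loop_free P -> 0 < B ->
    (forall i s, Inv i s -> i <= m -> bounded B s) ->
    (forall i s, Inv i s -> i <= m -> (eval s e != 0) = (i < m)) ->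
    (forall i s, Inv i s -> i < m -> Inv i.+1 (run P s)) ->
  forall s, Inv 0 s -> exists s' t,
    [/\ exec (While e P) s s' t, Inv m s'
      & t <= m.+1 * ((ecost e + pcost P) * B)].
Proof.
move=> lfP B_gt0 InvB InvE InvS.
suff H i s : i <= m -> Inv (m - i) s -> exists s' t,
    [/\ exec (While e P) s s' t, Inv m s'
      & t <= i.+1 * ((ecost e + pcost P) * B)].
  by move=> s Inv0; apply: H => //; rewrite subnn.
elim: i s => [|i IHi] s le_im inv_s.
  rewrite subn0 in inv_s; have sB := InvB _ _ inv_s (leqnn m).
  exists s, (eval_cost s e); split=> //.
    by apply: ExecWhileFalse; have := InvE _ _ inv_s (leqnn m); lia.
  by rewrite mul1n; apply: leq_trans (eval_cost_leq e B_gt0 sB) _; lia.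
have le1 : m - i.+1 <= m by lia.
have lt1 : m - i.+1 < m by lia.
have sB := InvB _ _ inv_s le1.
have [_ [t1 ex1 le_t1]] := exec_run lfP B_gt0 sB.
have inv1 := InvS _ _ inv_s lt1.
rewrite -subSn // subSS in inv1.
have [s' [t2 [ex2 inv' le_t2]]] := IHi _ (ltnW le_im) inv1.
exists s', (eval_cost s e + t1 + t2); split=> //.
  by apply: ExecWhileTrue ex1 ex2; rewrite (InvE _ _ inv_s).
rewrite mulSn leq_add //.
by rewrite mulnDl leq_add // eval_cost_leq.
Qed.

(** * Optimality of greedy strategies *)

Section Bellman.
Import Order.TTheory GRing.Theory Num.Theory.
Local Open Scope ring_scope.

(** The expectation of the payoff [g] at the leaves of the decision tree below the history [h], with
    [r] decisions to come and [f h d] the probability of deciding [d] after [h]. *)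
Fixpoint tree_sum (f : seq bool -> bool -> rat) (g : seq bool -> rat)
    (r : nat) (h : seq bool) : rat :=
  if r is r'.+1 then
    f h true * tree_sum f g r' (rcons h true) +
    f h false * tree_sum f g r' (rcons h false)
  else g h.

Lemma big_tuple_bool_recl (n : nat) (F : n.+1.-tuple bool -> rat) :
  \sum_w F w = \sum_(w : n.-tuple bool) F [tuple of true :: w] +
               \sum_(w : n.-tuple bool) F [tuple of false :: w].
Proof.
rewrite (reindex (fun p : bool * n.-tuple bool => [tuple of p.1 :: p.2])) /=.
  rewrite -(pair_bigA _ (fun d (w : n.-tuple bool) => F [tuple of d :: w])) /=.
  by rewrite big_bool.
exists (fun w => (thead w, [tuple of behead w])) => [[d w] _|w _] /=.
  by congr pair; apply: val_inj.
by rewrite -tuple_eta.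
Qed.

(** Splitting off the first decision turns the sum over all outcomes into the recursion on which
    backward induction operates; the prefix [h] is generalized for the induction. *)
Lemma tuple_tree_sum (n : nat) f g h :
  \sum_(w : n.-tuple bool)
     (\prod_(i < n) f (h ++ take i w) (tnth w i)) * g (h ++ w) =
  tree_sum f g n h.
Proof.
elim: n h => [|n IHn] h /=.
  rewrite (big_pred1 [tuple]) => [|w]; last by apply/esym/eqP; rewrite (tuple0 w).
  by rewrite big_ord0 mul1r cats0.
rewrite big_tuple_bool_recl -!IHn !mulr_sumr.
congr (_ + _); apply: eq_bigr => w _ /=;
  rewrite big_ord_recl take0 cats0 -mulrA cat_rcons; congr (_ * (_ * _));
  by apply: eq_bigr => i _; rewrite tnthS /= cat_rcons.
Qed.

Variables (k n' : nat) (S : society k n'.+1).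
Let n := n'.+1.

(** The step argument is recovered from the history. [inord] needs at least one area, so [n = 0] is
    treated apart, in [no_area_best]. *)
Definition next_area (tau : strategy n) (h : seq bool) : 'I_n :=
  tau (inord (size h)) h.

Definition scheduled (tau : strategy n) (h : seq bool) : seq 'I_n :=
  [seq next_area tau (take i h) | i <- iota 0 (size h)].

Lemma scheduled_rcons tau h d :
  scheduled tau (rcons h d) = rcons (scheduled tau h) (next_area tau h).
Proof.
rewrite /scheduled size_rcons -addn1 iotaD map_cat add0n /= cats1.
congr rcons; last by rewrite -cats1 take_size_cat.
by apply/eq_in_map => i; rewrite mem_iota -cats1 => hi; rewrite takel_cat //; lia.
Qed.

Lemma scheduled_uniqP tau :
  valid tau <-> (forall h, size h = n -> uniq (scheduled tau h)).
Proof.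
have E (w : n.-tuple bool) (i : 'I_n) :
    next_area tau (take i w) = tau i (take i w).
  rewrite /next_area size_take size_tuple ltn_ord; congr tau.
  by rewrite inord_val.
split=> [tau_valid h sz_h|uniq_tau w i i' eq_tau].
  have inj := tau_valid (Tuple (introT eqP sz_h)).
  rewrite map_inj_in_uniq ?iota_uniq // => i i'.
  rewrite !mem_iota /= sz_h => lt_i lt_i'.
  have := E (Tuple (introT eqP sz_h)) (Ordinal lt_i) => /= ->.
  have := E (Tuple (introT eqP sz_h)) (Ordinal lt_i') => /=.
  by move=> -> /inj /(congr1 val).
have := uniq_tau w (size_tuple w); rewrite /scheduled size_tuple.
move/(uniqP (i : 'I_n)) => inj; apply: val_inj; apply: inj.
- by rewrite inE size_map size_iota ltn_ord.
- by rewrite inE size_map size_iota ltn_ord.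
rewrite !(nth_map 0%N) ?size_iota ?ltn_ord // !nth_iota ?ltn_ord // !add0n.
by rewrite !E.
Qed.

(** Every shorter history extends to one of length [n], whose scheduled areas include those of
    [h]. *)
Lemma scheduled_uniq tau h :
  valid tau -> (size h <= n)%N -> uniq (scheduled tau h).
Proof.
move=> /scheduled_uniqP tau_valid; move: {2}(n - size h)%N (erefl (n - size h)%N).
move=> m; elim: m h => [|m IHm] h; first by move=> *; apply: tau_valid; lia.
move=> m_eq sz_h; have := IHm (rcons h true).
rewrite scheduled_rcons rcons_uniq size_rcons => IH.
by apply: (proj2 (andP (IH _ _))); lia.
Qed.

Definition decision_step (tau : strategy n) (h : seq bool) (d : bool) : rat :=
  decision_prob S (next_area tau h) (influence h) d.

Definition adopters (h : seq bool) : rat := (count id h)%:R.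

Lemma expected_adoptersE tau :
  expected_adopters S tau = tree_sum (decision_step tau) adopters n [::].
Proof.
rewrite -tuple_tree_sum; apply: eq_bigr => w _; congr (_ * _).
apply: eq_bigr => i _ /=; rewrite /decision_step /next_area.
congr (decision_prob S (tau _ _)).
by rewrite size_take size_tuple ltn_ord inord_val.
Qed.

Definition area_num (v : 'I_n) : nat := `|numq (prob S v)|.
Definition area_den (v : 'I_n) : nat := `|denq (prob S v)|.

(** The numerator, over [area_den v], of the acceptance probability at influence [x - n]; both
    threshold tests are rearranged to avoid negative numbers. *)
Definition scaled_prob (v : 'I_n) (x : nat) : nat :=
  if (n + threshold S v <= x)%N then area_den v
  else if (x + threshold S v <= n)%N then 0 else area_num v.

Lemma area_den_gt0 v : (0 < area_den v)%N.
Proof. by rewrite /area_den absz_gt0 denq_neq0. Qed.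

Lemma area_numE v : (area_num v)%:R = (area_den v)%:R * prob S v.
Proof.
rewrite -[in RHS](divq_num_den (prob S v)) mulrC.
have -> : (area_den v)%:R = (denq (prob S v))%:~R :> rat.
  by rewrite /area_den -[in RHS](gtz0_abs (denq_gt0 _)).
rewrite divfK ?intr_eq0 ?denq_neq0 //.
have num_ge0 : 0 <= numq (prob S v) by rewrite numq_ge0 prob_ge0.
by rewrite /area_num -[in RHS](gez0_abs num_ge0).
Qed.

(* [n] plus the influence, shifted so as to be a natural number. *)
Definition level (h : seq bool) : nat := (2 * count id h + (n - size h))%N.

Lemma influenceE h : influence h = (2 * count id h)%:Z - (size h)%:Z.
Proof.
rewrite /influence; elim: h => [|d h IHh]; first by rewrite big_nil.
by rewrite big_cons IHh; case: d => /=; lia.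
Qed.

Lemma scaled_probE v h : (size h <= n)%N ->
  (scaled_prob v (level h))%:R =
  (area_den v)%:R * accept_prob S v (influence h).
Proof.
move=> sz_h; rewrite /scaled_prob /accept_prob influenceE /level.
set c := threshold S v; set a := count id h.
have -> : (c%:Z <= (2 * a)%:Z - (size h)%:Z) = (n + c <= 2 * a + (n - size h))%N.
  by apply/idP/idP; lia.
have -> : ((2 * a)%:Z - (size h)%:Z <= - c%:Z) = (2 * a + (n - size h) + c <= n)%N.
  by apply/idP/idP; lia.
case: ifP => _; first by rewrite mulr1.
case: ifP => _; first by rewrite mulr0.
exact: area_numE.
Qed.

Lemma scaled_prob_le v x : (scaled_prob v x <= area_den v)%N.
Proof.
rewrite /scaled_prob; case: ifP => // _; case: ifP => // _.
rewrite -(ler_nat rat) area_numE ler_piMr ?ler0n //; exact: prob_le1.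
Qed.

Lemma level_rcons h d : (size h < n)%N ->
  level (rcons h d) = if d then (level h).+1 else (level h).-1.
Proof.
by rewrite /level size_rcons -cats1 count_cat /=; case: d => /=; lia.
Qed.

Definition type_size (j : 'I_k) : nat := #|[pred v | kind S v == j]|.

Definition remaining (tau : strategy n) (h : seq bool) (j : 'I_k) : nat :=
  (type_size j - count (fun v => kind S v == j) (scheduled tau h))%N.

Definition decr (m : 'I_k -> nat) (j : 'I_k) : 'I_k -> nat :=
  fun i => (m i - (i == j))%N.

Lemma remaining_rcons tau h d :
  remaining tau (rcons h d) =1 decr (remaining tau h) (kind S (next_area tau h)).
Proof.
move=> j; rewrite /remaining /decr scheduled_rcons -cats1 count_cat /= addn0.
by rewrite subnDA eq_sym.
Qed.

(** By validity the next area is distinct from all earlier ones, so even including it the scheduled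
    areas of its type number at most [type_size]. *)
Lemma remaining_gt0 tau h :
  valid tau -> (size h < n)%N ->
  (0 < remaining tau h (kind S (next_area tau h)))%N.
Proof.
move=> tau_valid lt_h; set v := next_area tau h.
have := scheduled_uniq tau_valid (h := rcons h true).
rewrite size_rcons scheduled_rcons -/v => /(_ lt_h) un.
rewrite subn_gt0 /type_size.
have := uniq_leq_size (filter_uniq (fun u => kind S u == kind S v) un).
move/(_ (enum [pred u | kind S u == kind S v])).
rewrite -cardE size_filter -cats1 count_cat /= eqxx addn0 addn1; apply.
by move=> u; rewrite mem_filter mem_enum inE => /andP[].
Qed.

Lemma sum_type_size : (\sum_j type_size j = n)%N.
Proof.
rewrite -[RHS]card_ord -sum1_card (partition_big (kind S) xpredT) //=.
by apply: eq_bigr => j _; rewrite /type_size -sum1_card.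
Qed.

(** The default 1 for a type without areas keeps [scale] positive. *)
Definition type_den (j : 'I_k) : nat :=
  if [pick v | kind S v == j] is Some v then area_den v else 1.

Lemma type_den_kind v : type_den (kind S v) = area_den v.
Proof.
rewrite /type_den; case: pickP => [u /eqP kind_u|/(_ v)]; last by rewrite eqxx.
by rewrite /area_den (kind_prob kind_u).
Qed.

Lemma scaled_prob_kind u v x :
  kind S u = kind S v -> scaled_prob u x = scaled_prob v x.
Proof.
move=> kind_u; rewrite /scaled_prob /area_den /area_num.
by rewrite (kind_prob kind_u) (kind_threshold kind_u).
Qed.

Definition scale (m : 'I_k -> nat) : nat := (\prod_j type_den j ^ m j)%N.

Lemma scale_decr m v : (0 < m (kind S v))%N ->
  scale m = (area_den v * scale (decr m (kind S v)))%N.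
Proof.
move=> m_gt0; rewrite /scale (bigD1 (kind S v)) //=.
rewrite [in RHS](bigD1 (kind S v)) //= type_den_kind mulnA -expnS /decr eqxx.
rewrite subn1 prednK //; congr muln; apply: eq_bigr => j /negPf ->.
by rewrite subn0.
Qed.

Lemma scale_gt0 m : (0 < scale m)%N.
Proof.
apply: prodn_gt0 => j; rewrite expn_gt0 /type_den.
by case: pickP => [v _|_]; rewrite ?area_den_gt0.
Qed.

Lemma eq_scale m m' : m =1 m' -> scale m = scale m'.
Proof. by move=> eq_m; apply: eq_bigr => j _; rewrite eq_m. Qed.


Lemma decr_sum m j : (0 < m j)%N -> (\sum_i decr m j i).+1 = (\sum_i m i)%N.
Proof.
move=> m_gt0; rewrite (bigD1 j) //= [RHS](bigD1 j) //= -addSn /decr eqxx.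
rewrite subn1 prednK //; congr addn; apply: eq_bigr => i /negPf ->.
by rewrite subn0.
Qed.

(** What the value recursion needs of a strategy: counts per type instead of distinctness of areas.
    It follows from [valid] by [remaining_gt0]; for the computed strategy it comes first, and
    [listed_valid] derives validity from it. *)
Definition schedulable (tau : strategy n) : Prop :=
  forall h, (size h < n)%N ->
    (0 < remaining tau h (kind S (next_area tau h)))%N.

Lemma sum_remaining tau h : schedulable tau -> (size h <= n)%N ->
  (\sum_j remaining tau h j + size h = n)%N.
Proof.
move=> tau_ok; elim/last_ind: h => [|h d IHh].
  move=> _; rewrite addn0 -[RHS]sum_type_size; apply: eq_bigr => j _.
  by rewrite /remaining subn0.
rewrite size_rcons => lt_h; rewrite -[RHS](IHh (ltnW lt_h)).
rewrite -(decr_sum (tau_ok h lt_h)) -addSnnS; congr ((_ + _).+1).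
by apply: eq_bigr => j _; rewrite remaining_rcons.
Qed.

Definition candidate (W : ('I_k -> nat) -> nat -> nat) (v : 'I_n)
    (m : 'I_k -> nat) (x : nat) : nat :=
  (scaled_prob v x * W (decr m (kind S v)) x.+1 +
   (area_den v - scaled_prob v x) * W (decr m (kind S v)) x.-1)%N.

(* [W m x] is twice the best expected final number of adopters when [m j] areas
   of type [j] remain and [n] plus the influence is [x], scaled by [scale m]
   in order to be a natural number. *)
Record value_function (W : ('I_k -> nat) -> nat -> nat) : Prop := ValueFunction {
  value_ext : forall m m' x, m =1 m' -> W m x = W m' x;
  value_end : forall m x, (forall j, m j = 0%N) -> (x <= 2 * n)%N -> W m x = x;
  value_max : forall m x v, (forall j, m j <= type_size j)%N ->
    (0 < x < 2 * n)%N -> (0 < m (kind S v))%N -> (candidate W v m x <= W m x)%N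
}.

Definition scaled_value (tau : strategy n) (r : nat) (h : seq bool) : rat :=
  tree_sum (decision_step tau) adopters r h *
  (2 * scale (remaining tau h))%:R.

(** Scheduling [v] removes one factor [area_den v] from the scale, and this factor turns the two
    decision probabilities into the integers [a] and [area_den v - a]. *)
Lemma scaled_value_rec tau r h : schedulable tau -> (size h < n)%N ->
  let v := next_area tau h in
  let a := scaled_prob v (level h) in
  scaled_value tau r.+1 h =
  a%:R * scaled_value tau r (rcons h true) +
  (area_den v - a)%:R * scaled_value tau r (rcons h false).
Proof.
move=> tau_ok lt_h v a; rewrite /scaled_value /=.
rewrite !(eq_scale (remaining_rcons tau h _)).
rewrite (scale_decr (tau_ok h lt_h)) -/v.
rewrite natrB ?scaled_prob_le // scaled_probE ?(ltnW lt_h) //.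
rewrite /decision_step /decision_prob -/v !natrM; ring.
Qed.

Lemma level_bounds h : (size h < n)%N -> (0 < level h < 2 * n)%N.
Proof. by have := count_size id h; rewrite /level; lia. Qed.

Lemma remaining_le tau h j : (remaining tau h j <= type_size j)%N.
Proof. exact: leq_subr. Qed.

Section Values.
Variables (W : ('I_k -> nat) -> nat -> nat) (W_value : value_function W).

Lemma scaled_value_end tau h : schedulable tau -> size h = n ->
  scaled_value tau 0 h = (W (remaining tau h) (level h))%:R.
Proof.
move=> tau_ok sz_h; have := sum_remaining tau_ok (eq_leq sz_h).
rewrite sz_h => /eqP; rewrite -[X in _ == X]add0n eqn_add2r sum_nat_eq0.
move=> /forall_inP rem0.
have rem0' j : remaining tau h j = 0%N by apply/eqP/rem0.
rewrite (value_end W_value rem0') /level sz_h subnn addn0; last first.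
  by rewrite -sz_h leq_mul2l count_size.
rewrite /scaled_value /= /scale big1 ?muln1 => [|j _]; last by rewrite rem0'.
by rewrite /adopters -natrM mulnC.
Qed.

(** Backward induction: the coefficients of the recursion are nonnegative, so bounds on both
    children give the bound [candidate], hence [W], on the parent. *)
Lemma scaled_value_le tau r h : schedulable tau -> (size h + r = n)%N ->
  scaled_value tau r h <= (W (remaining tau h) (level h))%:R.
Proof.
move=> tau_ok; elim: r h => [|r IHr] h sz_h.
  by rewrite (scaled_value_end tau_ok) //; lia.
have lt_h : (size h < n)%N by lia.
rewrite scaled_value_rec //; set v := next_area tau h.
have le_cand := value_max W_value (remaining_le tau h) (level_bounds lt_h)
                          (tau_ok h lt_h).
rewrite -(ler_nat rat) in le_cand; apply: le_trans le_cand.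
rewrite /candidate natrD !natrM lerD // ler_wpM2l ?ler0n //.
- have := IHr (rcons h true); rewrite size_rcons level_rcons //.
  by rewrite (value_ext W_value _ (remaining_rcons tau h true)); apply; lia.
- have := IHr (rcons h false); rewrite size_rcons level_rcons //.
  by rewrite (value_ext W_value _ (remaining_rcons tau h false)); apply; lia.
Qed.

(** Equality where [value_max] gives an inequality, so that the upper bound [W] is attained. *)
Definition greedy (tau : strategy n) : Prop :=
  forall h, (size h < n)%N ->
    W (remaining tau h) (level h) =
    candidate W (next_area tau h) (remaining tau h) (level h).

Lemma scaled_value_greedy tau r h :
    schedulable tau -> greedy tau -> (size h + r = n)%N ->
  scaled_value tau r h = (W (remaining tau h) (level h))%:R.
Proof.
move=> tau_ok tau_greedy; elim: r h => [|r IHr] h sz_h.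
  by rewrite (scaled_value_end tau_ok) //; lia.
have lt_h : (size h < n)%N by lia.
rewrite scaled_value_rec // tau_greedy // /candidate natrD !natrM.
rewrite !IHr ?size_rcons; [|lia|lia]; rewrite !level_rcons //.
by rewrite !(value_ext W_value _ (remaining_rcons tau h _)).
Qed.

Lemma greedy_best sigma :
  valid sigma -> schedulable sigma -> greedy sigma -> best S sigma.
Proof.
move=> sigma_valid sigma_ok sigma_greedy; split=> // tau tau_valid.
have tau_ok : schedulable tau by move=> h; apply: remaining_gt0.
rewrite !expected_adoptersE.
(* At the empty history all strategies face the same situation, so the expectations to be compared
   carry the same positive scale. *)
have scale0 t : scale (remaining t [::]) = scale type_size.
  by apply: eq_scale => j; rewrite /remaining subn0.
have pos : 0 < (2 * scale type_size)%:R :> rat.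
  by rewrite ltr0n muln_gt0 scale_gt0.
rewrite -(ler_pM2r pos).
have := scaled_value_le tau_ok (erefl : (size (@nil bool) + n = n)%N).
have eqW : W (remaining tau [::]) (level [::]) =
           W (remaining sigma [::]) (level [::]).
  by apply: (value_ext W_value) => j; rewrite /remaining.
rewrite eqW.
rewrite -(@scaled_value_greedy sigma n [::]) // /scaled_value.
by rewrite !scale0.
Qed.

End Values.

(* Areas of a type are scheduled by decreasing position in the list of their
   type, hence never twice. *)
Lemma listed_valid (e : nat -> nat -> nat) sigma :
    (forall (j : 'I_k) r r', (0 < r <= type_size j)%N ->
       (0 < r' <= type_size j)%N -> e j r = e j r' -> r = r') ->
    schedulable sigma ->
    (forall h, (size h < n)%N -> let v := next_area sigma h in
       v = e (kind S v) (remaining sigma h (kind S v)) :> nat) ->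
  valid sigma.
Proof.
move=> e_inj sigma_ok sigma_list; apply/scheduled_uniqP => h sz_h.
have {sz_h} : (size h <= n)%N by rewrite sz_h.
(* The strengthened invariant: each scheduled area stands in the list of its type at a position
   above the number remaining, whereas the next area stands exactly at that number. *)
suff H : (size h <= n)%N -> uniq (scheduled sigma h) /\
    forall v, v \in scheduled sigma h -> exists2 r,
      (remaining sigma h (kind S v) < r <= type_size (kind S v))%N
      & v = e (kind S v) r :> nat.
  by move=> /H[].
elim/last_ind: h => [|h d IHh]; first by [].
rewrite size_rcons => lt_h; have [un_h list_h] := IHh (ltnW lt_h).
rewrite scheduled_rcons rcons_uniq; set v := next_area sigma h.
have v_gt0 := sigma_ok h lt_h; have v_list := sigma_list h lt_h.
rewrite -/v /= in v_gt0 v_list.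
have v_le := remaining_le sigma h (kind S v).
split; last first.
  move=> u; rewrite mem_rcons inE => /orP[/eqP ->|/list_h[r lt_r eq_u]].
    exists (remaining sigma h (kind S v)) => //.
    by rewrite remaining_rcons -/v /decr eqxx; lia.
  by exists r => //; rewrite remaining_rcons -/v /decr; lia.
rewrite un_h andbT; apply/negP => /list_h[r lt_r].
by rewrite {1}v_list => /e_inj; lia.
Qed.

End Bellman.

Lemma no_area_best k (S : society k 0) (sigma : strategy 0) : best S sigma.
Proof.
split=> [w []//|tau _].
suff -> : expected_adopters S tau = expected_adopters S sigma by [].
by apply: eq_bigr => w _; rewrite /outcome_prob !big_ord0.
Qed.

(** * The program *)

Declare Scope prog_scope.
Delimit Scope prog_scope with P.
Bind Scope prog_scope with expr program.
Notation "# m" := (Cst m) (at level 8, m at level 0, format "# m") : prog_scope.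
Notation "$ x" := (Reg x) (at level 8, x at level 0, format "$ x") : prog_scope.
Notation "e1 + e2" := (Bin Add e1 e2) : prog_scope.
Notation "e1 - e2" := (Bin Sub e1 e2) : prog_scope.
Notation "e1 * e2" := (Bin Mul e1 e2) : prog_scope.
Notation "e1 %/ e2" := (Bin Div e1 e2) : prog_scope.
Notation "e1 %% e2" := (Bin Mod e1 e2) : prog_scope.
Notation "e1 < e2" := (Bin Lt e1 e2) : prog_scope.
Notation "e1 == e2" := (Bin Eq e1 e2) : prog_scope.
Notation "x ::= e" := (Assign x e%P) (at level 75, no associativity) : prog_scope.
Notation "e1 <~ e2" := (Store e1%P e2%P)
  (at level 75, no associativity) : prog_scope.
Notation "P ;; Q" := (Seq P Q)
  (at level 80, right associativity, format "'[v' P ;; '/' Q ']'") : prog_scope.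

(* [rBW], [rBP] and [rBA] hold the value, the weight [b ^ j.+1] and the area of
   the best candidate found so far; weight 0 means that there is none. *)
Notation rRoot := 0 (only parsing).
Notation rN := 1 (only parsing).
Notation rB := 2 (only parsing).
Notation rL := 3 (only parsing).
Notation rBase := 4 (only parsing).
Notation rI := 5 (only parsing).
Notation rM := 6 (only parsing).
Notation rT := 7 (only parsing).
Notation rJ := 8 (only parsing).
Notation rP := 9 (only parsing).
Notation rX := 10 (only parsing).
Notation rBW := 11 (only parsing).
Notation rBP := 12 (only parsing).
Notation rBA := 13 (only parsing).
Notation rD := 14 (only parsing).
Notation rV := 15 (only parsing).
Notation rVal := 16 (only parsing).
Notation rA := 17 (only parsing).

(* Memory layout, with [b := 2 * n + 1]: the input occupies the addresses below
   [L := 4 * n + 1]; the list of the areas of type [j] starts at [L + j * b] with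
   its length; the node [z] occupies four cells from [L + k * b + 4 * z] on, the
   last of which holds its scaled value. *)
Definition setup_prog : program := (
  rN ::= Read #0 ;;
  rB ::= #2 * $rN + #1 ;;
  rL ::= #4 * $rN + #1)%P.

(** The length cell, at address [rT], is incremented first, so that it gives the position at which
    area [rI] is appended. *)
Definition list_prog : program := (
  rT ::= $rL + Read (#4 * $rI + #1) * $rB ;;
  $rT <~ Read $rT + #1 ;;
  $rT + Read $rT <~ $rI ;;
  rI ::= $rI + #1 ;;
  rT ::= #0)%P.

Definition root_step : program := (
  rRoot ::= $rRoot + Read $rJ * $rP ;;
  rJ ::= $rJ + $rB ;;
  rP ::= $rP * $rB)%P.

(** The initial situation has lowest digit [n], for influence 0, and the list lengths as further
    digits. After the pass, [rJ] is the address of the first node and [rP] the number [b ^ k.+1] of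
    nodes. *)
Definition root_prog (k : nat) : program := (
  rRoot ::= $rN ;; rJ ::= $rL ;; rP ::= $rB ;;
  repeat k root_step ;;
  rBase ::= $rJ ;; rM ::= $rP ;; rRoot ::= $rBase + #4 * $rRoot ;;
  rI ::= #0 ;; rJ ::= #0 ;; rP ::= #0)%P.

(** The digit [rD] counts the areas of the type that remain, and [rV] is the area at that position
    of its list. For [rD = 0] the cell read is the length of the list; the result is then
    meaningless and [choice_update] discards it. *)
Definition candidate_prog : program := (
  rD ::= $rI %/ $rP %% $rB ;;
  rV ::= Read ($rJ + $rD) ;;
  If ($rX < $rN + Read (#4 * $rV + #2))
     (If ($rN < $rX + Read (#4 * $rV + #2))
         (rA ::= Read (#4 * $rV + #3))
         (rA ::= #0))
     (rA ::= Read (#4 * $rV + #4)) ;;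
  rVal ::= $rA * Read ($rBase + #4 * ($rI + #1 - $rP) + #3)
    + (Read (#4 * $rV + #4) - $rA)
        * Read ($rBase + #4 * ($rI - #1 - $rP) + #3))%P.

(** Products and sums of tests act as conjunctions and disjunctions. The first available candidate
    is taken whatever its value, since [rBW] then only holds the default for the absence of
    candidates. *)
Definition choice_update : program := (
  If ((#0 < $rD) * (#0 < $rX) * ($rX < #2 * $rN)
        * (($rBP == #0) + ($rBW < $rVal)))
     (rBW ::= $rVal ;; rBP ::= $rP ;; rBA ::= $rV)
     Skip ;;
  rJ ::= $rJ + $rB ;;
  rP ::= $rP * $rB)%P.

Definition choice_step : program := (candidate_prog ;; choice_update)%P.

(** The default value [rX] is the correct one when no area remains: it is then twice the number of
    adopters. *)
Definition choice_init : program := (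
  rX ::= $rI %% $rB ;; rBW ::= $rX ;; rBP ::= #0 ;; rBA ::= #0 ;;
  rJ ::= $rL ;; rP ::= $rB)%P.

Definition node_stores : program := (
  $rBase + #4 * $rI <~ $rBA ;;
  $rBase + #4 * $rI + #1 <~ $rBase + #4 * ($rI + #1 - $rBP) ;;
  $rBase + #4 * $rI + #2 <~ $rBase + #4 * ($rI - #1 - $rBP) ;;
  $rBase + #4 * $rI + #3 <~ $rBW)%P.

(* Clearing the auxiliary registers makes one bound on all values an invariant of
   the loop. *)
Definition node_reset : program := (
  rI ::= $rI + #1 ;;
  rJ ::= #0 ;; rP ::= #0 ;; rX ::= #0 ;; rBW ::= #0 ;; rBP ::= #0 ;;
  rBA ::= #0 ;; rD ::= #0 ;; rV ::= #0 ;; rVal ::= #0 ;; rA ::= #0)%P.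

Definition node_prog (k : nat) : program :=
  (choice_init ;; repeat k choice_step ;; node_stores ;; node_reset)%P.

Definition diagram_prog (k : nat) : program := (
  setup_prog ;;
  While ($rI < $rN) list_prog ;;
  root_prog k ;;
  While ($rI < $rM) (node_prog k))%P.

Definition scaled (n x c p q : nat) : nat :=
  if n + c <= x then q else if x + c <= n then 0 else p.

Lemma run_candidate_prog s :
  let y := regs s rI in let n := regs s rN in
  let dg := y %/ regs s rP %% regs s rB in
  let v := mem s (regs s rJ + dg) in
  let a := scaled n (regs s rX) (mem s (4 * v + 2)) (mem s (4 * v + 3))
                  (mem s (4 * v + 4)) in
  let W z := mem s (regs s rBase + 4 * z + 3) in
  let s' := run candidate_prog s in
  [/\ regs s' rD = dg, regs s' rV = v &
     regs s' rVal =
     a * W (y + 1 - regs s rP) + (mem s (4 * v + 4) - a) * W (y - 1 - regs s rP)].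
Proof.
move=> /=; rewrite /scaled !eqb0 -!leqNgt !if_neg.
by do 2?[case: ifP => _ /=]; split.
Qed.

Lemma run_choice_step s :
  let s1 := run candidate_prog s in
  let s' := run choice_step s in
  let better := [&& 0 < regs s1 rD, 0 < regs s rX, regs s rX < 2 * regs s rN &
                  (regs s rBP == 0) || (regs s rBW < regs s1 rVal)] in
  [/\ regs s' rJ = regs s rJ + regs s rB,
      regs s' rP = regs s rP * regs s rB,
      regs s' rBW = if better then regs s1 rVal else regs s rBW,
      regs s' rBP = if better then regs s rP else regs s rBP &
      regs s' rBA = if better then regs s1 rV else regs s rBA].
Proof.
have keep x : x \notin writes candidate_prog ->
    regs (run candidate_prog s) x = regs s x by exact: run_regs.
move=> s1 s' better.
have -> : s' = run choice_update s1 by [].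
rewrite /better {s' better}; rewrite -/s1 in keep; clearbody s1.
have [k1 k2 k8 k9 k10] : [/\ regs s1 rN = regs s rN, regs s1 rB = regs s rB,
  regs s1 rJ = regs s rJ, regs s1 rP = regs s rP & regs s1 rX = regs s rX].
  by split; apply: keep.
have [k11 k12 k13] : [/\ regs s1 rBW = regs s rBW, regs s1 rBP = regs s rBP &
   regs s1 rBA = regs s rBA] by split; apply: keep.
rewrite /= -k1 -k2 -k8 -k9 -k10 -k11 -k12 -k13.
case: (0 < regs s1 14) => //=; case: (0 < regs s1 10) => //=.
case: (regs s1 10 < _) => //=.
by case: (regs s1 12 == 0); case: (regs s1 11 < _).
Qed.

(** * Nodes as numbers in base [b] *)

Section Radix.
Variable b : nat.
Hypothesis b_gt0 : 0 < b.

Definition digit (z i : nat) : nat := z %/ b ^ i %% b.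

Definition from_digits (m : nat) (f : nat -> nat) : nat :=
  \sum_(i < m) f i * b ^ i.

Lemma from_digitsS m f :
  from_digits m.+1 f = f 0 + b * from_digits m (fun i => f i.+1).
Proof.
rewrite /from_digits big_ord_recl expn0 muln1 big_distrr /=; congr addn.
by apply: eq_bigr => i _; rewrite expnS mulnCA.
Qed.

Lemma eq_from_digits m f g :
  (forall i, i < m -> f i = g i) -> from_digits m f = from_digits m g.
Proof. by move=> eq_fg; apply: eq_bigr => i _; rewrite eq_fg. Qed.

Lemma from_digits_lt m f :
  (forall i, i < m -> f i < b) -> from_digits m f < b ^ m.
Proof.
elim: m f => [|m IHm] f lt_f; first by rewrite /from_digits big_ord0.
rewrite from_digitsS expnS.
have := IHm (fun i => f i.+1) (fun i => lt_f i.+1).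
have := lt_f 0 isT; set u := from_digits _ _; set v := b ^ m; nia.
Qed.

Lemma digitS z i : digit z i.+1 = digit (z %/ b) i.
Proof. by rewrite /digit expnS divnMA. Qed.

Lemma digit_from m f i :
  (forall i, i < m -> f i < b) -> i < m -> digit (from_digits m f) i = f i.
Proof.
elim: m f i => [|m IHm] f [|i] // lt_f lt_i; rewrite from_digitsS.
  by rewrite /digit expn0 divn1 mulnC addnC modnMDl modn_small // lt_f.
rewrite digitS mulnC addnC divnMDl // divn_small ?lt_f // addn0.
by rewrite (IHm (fun i => f i.+1)) // => i' lt_i'; apply: lt_f.
Qed.

Lemma from_digits_digit m z : z < b ^ m -> from_digits m (digit z) = z.
Proof.
elim: m z => [|m IHm] z.
  by rewrite expn0 ltnS leqn0 => /eqP ->; rewrite /from_digits big_ord0.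
rewrite expnSr => lt_z; rewrite from_digitsS.
have -> : from_digits m (fun i => digit z i.+1) = z %/ b.
  rewrite -[RHS]IHm ?ltn_divLR //.
  by apply: eq_from_digits => i _; rewrite digitS.
by rewrite /digit expn0 divn1 [RHS](divn_eq z b) addnC mulnC.
Qed.

Lemma digit_lt z i : digit z i < b.
Proof. by rewrite ltn_mod. Qed.

Lemma from_digitsD1 m f i : i < m ->
  from_digits m f =
  f i * b ^ i + from_digits m (fun i' => if i' == i then 0 else f i').
Proof.
move=> lt_i; pose i0 := Ordinal lt_i; rewrite /from_digits (bigD1 i0) //=.
congr addn; rewrite [RHS](bigD1 i0) //= eqxx mul0n add0n.
by apply: eq_bigr => i' ne_i'; rewrite -[(i' : nat) == i]/(i' == i0) (negPf ne_i').
Qed.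

(** The bounds on the two digits exclude carries and borrows, so arithmetic on codes acts digitwise.
    The weight [b ^ j.+1] exceeds the 1 that may be added, so children precede their parent. *)
Lemma child_digits k z j (d : bool) : j < k -> z < b ^ k.+1 ->
    0 < digit z j.+1 -> 0 < digit z 0 -> (digit z 0).+1 < b ->
  let z' := (if d then z + 1 else z - 1) - b ^ j.+1 in
  [/\ z' < z, z' < b ^ k.+1,
      digit z' 0 = if d then (digit z 0).+1 else (digit z 0).-1 &
      forall i, i < k -> digit z' i.+1 = digit z i.+1 - (i == j)].
Proof.
move=> lt_j lt_z m_gt0 x_gt0 x_lt z'.
pose f i := if i is i'.+1 then digit z i - (i' == j)
            else if d then (digit z 0).+1 else (digit z 0).-1.
have f_lt i : i < k.+1 -> f i < b.
  case: i => [|i] _ /=; last by apply: leq_ltn_trans (leq_subr _ _) (digit_lt _ _).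
  by case: d z' f => *; lia.
have bj : 0 < b ^ j by rewrite expn_gt0 b_gt0.
have bj1 : 1 < b ^ j.+1 by rewrite expnS; nia.
have Ez := from_digits_digit lt_z.
have Ef : from_digits k.+1 f = z'.
  (* Isolating digits [j.+1] and 0 on both sides leaves a common rest; positivity of both digits
     then makes the truncated subtractions exact. *)
  rewrite /z' -[in RHS]Ez (from_digitsD1 f (lt_j : j.+1 < k.+1)).
  rewrite (from_digitsD1 (digit z) (lt_j : j.+1 < k.+1)) !from_digitsS /= eqxx.
  set g1 := from_digits _ _; set g2 := from_digits _ _.
  have -> : g1 = g2.
    by apply: eq_from_digits => i _; rewrite eqSS; case: eqP; rewrite ?subn0.
  set B := b ^ j.+1 in bj1 *; have : 1 <= digit z j.+1 by [].
  move: (digit z j.+1) (digit z 0) x_gt0 => [|u] [|v] // _ _.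
  by rewrite subn1 mulSn; case: (d) => /=; lia.
rewrite -Ef; split.
- have z_gt0 : 0 < z by case: (posnP z) x_gt0 => // ->; rewrite /digit div0n mod0n.
  by rewrite Ef /z'; case: (d); lia.
- exact: from_digits_lt.
- by rewrite digit_from.
- by move=> i lt_i; rewrite digit_from.
Qed.

End Radix.

(** * Nodes in memory: local correctness, size of values, and the computation of one node *)

Section Nodes.
(* [M1] is the memory after the construction of the lists of areas. *)
Variables (k n : nat) (M1 : nat -> nat).
Notation b := (2 * n + 1).
Notation L := (4 * n + 1).
Notation base := (L + k * b).

Definition entry (j r : nat) : nat := M1 (L + j * b + r).

Definition available (z j : nat) : bool :=
  [&& 0 < digit b z j.+1, 0 < digit b z 0 & digit b z 0 < 2 * n].

Definition child (z p : nat) (d : bool) : nat :=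
  (if d then z + 1 else z - 1) - p.

Definition node_value (M : nat -> nat) (z : nat) : nat := M (base + 4 * z + 3).

Definition candidate_value (M : nat -> nat) (z j : nat) : nat :=
  let v := entry j (digit b z j.+1) in
  let a := scaled n (digit b z 0) (M1 (4 * v + 2)) (M1 (4 * v + 3))
                  (M1 (4 * v + 4)) in
  a * node_value M (child z (b ^ j.+1) true) +
  (M1 (4 * v + 4) - a) * node_value M (child z (b ^ j.+1) false).

(* [w], [p] and [a] are the value, the weight [b ^ i.+1] and the area of a best
   candidate [i < j]; if no candidate is available then [p = 0]. *)
Definition best_choice (M : nat -> nat) (z j w p a : nat) : Prop :=
  [/\ p = 0, w = digit b z 0, a = 0 & forall i, i < j -> ~~ available z i] \/
  exists i, [/\ i < j /\ available z i, p = b ^ i.+1,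
    a = entry i (digit b z i.+1), w = candidate_value M z i &
    forall i', i' < j -> available z i' -> candidate_value M z i' <= w].

(** The weight [p] of the choice is not stored in the node itself, only in its two links; hence the
    existential. *)
Definition node_ok (M : nat -> nat) (z : nat) : Prop :=
  exists p, [/\ best_choice M z k (node_value M z) p (M (base + 4 * z)),
    M (base + 4 * z + 1) = base + 4 * child z p true &
    M (base + 4 * z + 2) = base + 4 * child z p false].

Lemma best_choiceS M z j w p a :
    best_choice M z j w p a ->
    let better := available z j && ((p == 0) || (w < candidate_value M z j)) in
  best_choice M z j.+1 (if better then candidate_value M z j else w)
    (if better then b ^ j.+1 else p)
    (if better then entry j (digit b z j.+1) else a).
Proof.
have pow_gt0 i : 0 < b ^ i by rewrite expn_gt0 addn1.
case=> [[-> -> -> none]|[i [[lt_i av_i] -> -> -> max_i]]] /=.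
  case: ifP => [/andP[av_j _]|/negbT]; last first.
    rewrite andbT => av_j; left; split=> // i.
    by rewrite ltnS leq_eqVlt => /orP[/eqP ->|/none].
  right; exists j; split=> // i'; rewrite ltnS leq_eqVlt => /orP[/eqP -> //|].
  by move=> /none/negPf ->.
rewrite eqn0Ngt pow_gt0 /=; case: ifP => [/andP[av_j lt_j]|/negbT not_j]; right.
  exists j; split=> // i'; rewrite ltnS leq_eqVlt => /orP[/eqP -> //|lt_i' av_i'].
  exact: leq_trans (max_i _ lt_i' av_i') (ltnW lt_j).
exists i; split; [by split; [lia|]|by []..|].
move=> i'; rewrite ltnS leq_eqVlt => /orP[/eqP -> av_j|]; last exact: max_i.
by move: not_j; rewrite av_j /= -leqNgt.
Qed.

(** From [M] only the value cells of the two children are read, and these lie below the node [z]. *)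
Lemma eq_candidate_value M M' z j : j < k -> z < b ^ k.+1 ->
    (forall a, a < base + 4 * z -> M' a = M a) -> available z j ->
  candidate_value M' z j = candidate_value M z j.
Proof.
move=> lt_j lt_z eqM /and3P[av1 av2 av3].
have b_gt0 : 0 < b by rewrite addn1.
have lt_c d : child z (b ^ j.+1) d < z.
  have [] // := @child_digits _ b_gt0 k z j d lt_j lt_z av1 av2.
  by move: av3; lia.
by rewrite /candidate_value /node_value !eqM //;
  have := lt_c true; have := lt_c false; lia.
Qed.

Lemma best_choice_frame M M' z w p a : z < b ^ k.+1 ->
    (forall a, a < base + 4 * z -> M' a = M a) ->
  best_choice M z k w p a -> best_choice M' z k w p a.
Proof.
move=> lt_z eqM [|[i [[lt_i av_i] pE aE wE max_i]]]; first by left.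
right; exists i; split=> //; first by rewrite wE (eq_candidate_value _ _ eqM).
move=> i' lt_i' av_i'; rewrite (eq_candidate_value _ _ eqM) //.
exact: max_i.
Qed.

Lemma node_ok_frame M M' z : z < b ^ k.+1 ->
  (forall a, a < base + 4 * z.+1 -> M' a = M a) -> node_ok M z -> node_ok M' z.
Proof.
move=> lt_z eqM [p [best1 acc rej]]; exists p.
rewrite /node_value !eqM; [|lia..]; split=> //.
by apply: best_choice_frame best1 => // a lt_a; apply: eqM; lia.
Qed.

(** The number of areas that remain in the situation [z]; it is the exponent in the bound on
    values. *)
Definition digit_sum (z : nat) : nat := \sum_(j < k) digit b z j.+1.

Lemma digit_sum_child z j d : j < k -> z < b ^ k.+1 -> available z j ->
  (digit_sum (child z (b ^ j.+1) d)).+1 = digit_sum z.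
Proof.
move=> lt_j lt_z /and3P[av1 av2 av3].
have b_gt0 : 0 < b by rewrite addn1.
have lt_x : (digit b z 0).+1 < b by move: av3; lia.
have [_ _ _ dig] := child_digits b_gt0 d lt_j lt_z av1 av2 lt_x.
pose j0 := Ordinal lt_j; rewrite /digit_sum (bigD1 j0) //= [RHS](bigD1 j0) //=.
rewrite dig // eqxx -addSn subn1 prednK //; congr addn.
apply: eq_bigr => i ne_i; rewrite dig // -[(i : nat) == j]/(i == j0) (negPf ne_i).
by rewrite subn0.
Qed.

(** Without a candidate the value is a digit, at most [2 * n]. Each scheduled area multiplies the
    bound by at most [2 * Q], as both integer coefficients are at most [Q]; so the bit length stays
    polynomial. *)
Lemma node_value_le M y Q :
    0 < Q -> (forall a, a < base -> M1 a <= Q) -> y <= b ^ k.+1 ->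
    (forall j r, j < k -> 0 < r < b -> entry j r <= n.-1) ->
    (forall z, z < y -> node_ok M z) ->
  forall z, z < y -> node_value M z <= 2 * n * (2 * Q) ^ digit_sum z.
Proof.
move=> Q_gt0 leQ le_y le_entry ok z; elim/ltn_ind: z => z IHz lt_z.
have b_gt0 : 0 < b by rewrite addn1.
have lt_zb : z < b ^ k.+1 by exact: leq_trans le_y.
have [p [best1 _ _]] := ok z lt_z.
case: best1 => [[_ -> _ _]|[j [[lt_j av_j] _ _ -> _]]].
  apply: leq_trans (_ : 2 * n <= _); first by have := digit_lt b_gt0 z 0; lia.
  by rewrite leq_pmulr // expn_gt0 muln_gt0 Q_gt0.
have [av1 av2 av3] := and3P av_j.
have lt_x : (digit b z 0).+1 < b by move: av3; lia.
have child_le d : node_value M (child z (b ^ j.+1) d) <=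
    2 * n * (2 * Q) ^ (digit_sum z).-1.
  have [lt_c _ _ _] := child_digits b_gt0 d lt_j lt_zb av1 av2 lt_x.
  rewrite -(digit_sum_child d lt_j lt_zb av_j) /=; apply: IHz => //.
  exact: ltn_trans lt_z.
rewrite -(digit_sum_child true lt_j lt_zb av_j) expnS.
rewrite -(digit_sum_child true lt_j lt_zb av_j) /= in child_le.
set T := (2 * Q) ^ digit_sum (child z (b ^ j.+1) true) in child_le *.
clearbody T.
rewrite /candidate_value; set v := entry _ _.
(* Situations whose digits exceed the list lengths are evaluated too; [le_entry] covers their
   entries as well, so the record read always lies inside the input. *)
have v_lt : 4 * v + 4 < base.
  have := le_entry j (digit b z j.+1) lt_j.
  by rewrite av1 digit_lt // => /(_ isT); lia.
have aQ : scaled n (digit b z 0) (M1 (4 * v + 2)) (M1 (4 * v + 3))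
                  (M1 (4 * v + 4)) <= Q.
  by rewrite /scaled; do 2?[case: ifP => _ //]; apply: leQ; lia.
have := leQ _ v_lt; move: (M1 (4 * v + 4)) aQ => /= q.
move: (child_le true) (child_le false).
move: (scaled _ _ _ _ _) (node_value _ _) (node_value _ _) => a' w2 w1 l1 l2 aQ qQ.
have h1 : a' * w1 <= Q * (2 * n * T) by exact: leq_mul.
have h2 : (q - a') * w2 <= Q * (2 * n * T).
  by apply: leq_mul => //; apply: leq_trans qQ; apply: leq_subr.
lia.
Qed.

Definition fixed_regs (s : state) : Prop :=
  [/\ regs s rN = n, regs s rB = b, regs s rL = L & regs s rBase = base].

Lemma run_node_stores s a :
  let node := regs s rBase + 4 * regs s rI in
  mem (run node_stores s) a =
    if a == node + 3 then regs s rBW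
    else if a == node + 2
      then regs s rBase + 4 * child (regs s rI) (regs s rBP) false
    else if a == node + 1
      then regs s rBase + 4 * child (regs s rI) (regs s rBP) true
    else if a == node then regs s rBA
    else mem s a.
Proof. by []. Qed.

Section NodeRun.
Variables (s : state) (y : nat).
Hypothesis (s_fixed : fixed_regs s) (s_y : regs s rI = y).
Hypothesis (s_mem : forall a, a < base -> mem s a = M1 a).
Hypothesis (entry_le : forall j r, j < k -> 0 < r < b -> entry j r <= n.-1).

Definition choice_state (i : nat) : state :=
  iter i (run choice_step) (run choice_init s).

Lemma choice_stateP i : i <= k ->
  let s' := choice_state i in
  [/\ fixed_regs s' /\ regs s' rI = y, mem s' = mem s,
      [/\ regs s' rJ = L + i * b, regs s' rP = b ^ i.+1 &
          regs s' rX = digit b y 0] &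
      best_choice (mem s) y i (regs s' rBW) (regs s' rBP) (regs s' rBA)].
Proof.
have b_gt0 : 0 < b by rewrite addn1.
have [sN sB sL sBase] := s_fixed.
elim: i => [_|i IHi lt_i] s'.
  rewrite {}/s' /choice_state /=; split=> //.
    rewrite sL sB s_y mul0n addn0 /digit expn0 divn1.
    by split.
  by left; rewrite s_y sB /digit expn0 divn1.
rewrite {}/s' /choice_state iterS -/(choice_state i).
have [[[fN fB fL fBase] fI] fmem [fJ fP fX] best_i] := IHi (ltnW lt_i).
set s1 := choice_state i in fN fB fL fBase fI fmem fJ fP fX best_i *.
have keep x : x \notin writes choice_step ->
    regs (run choice_step s1) x = regs s1 x by exact: run_regs.
have [cD cV cVal] := run_candidate_prog s1.
have [uJ uP uW uBP uA] := run_choice_step s1.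
rewrite cD cV cVal fN fB fBase fI fmem fJ fP fX -/(digit b y i.+1) in uW uBP uA.
rewrite {cD cV cVal}fJ fB in uJ; rewrite fP fB in uP.
split; first by rewrite /fixed_regs !keep.
- by rewrite run_mem // fmem.
- by split; [rewrite uJ mulSn; lia | rewrite uP [RHS]expnSr | rewrite keep].
have v_eq : mem s (L + i * b + digit b y i.+1) = entry i (digit b y i.+1).
  by apply: s_mem; have := digit_lt b_gt0 y i.+1; nia.
have av_eq c : [&& 0 < digit b y i.+1, 0 < digit b y 0, digit b y 0 < 2 * n & c] =
    available y i && c by rewrite /available -!andbA.
have := best_choiceS best_i; rewrite uW uBP uA v_eq !av_eq.
case: (boolP (available y i)) => // av_i.
have lt_v : 4 * entry i (digit b y i.+1) + 4 < base.
  have [av1 _ av3] := and3P av_i.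
  have := entry_le lt_i (r := digit b y i.+1).
  rewrite av1 digit_lt // => /(_ isT) le_v.
  by apply: leq_trans (leq_addr _ _); lia.
have eq4 c : c <= 4 -> mem s (4 * entry i (digit b y i.+1) + c) =
    M1 (4 * entry i (digit b y i.+1) + c).
  by move=> le_c; apply: s_mem; apply: leq_ltn_trans lt_v; rewrite leq_add2l.
by rewrite /candidate_value !eq4.
Qed.

Lemma run_node_prog :
  let s' := run (node_prog k) s in
  [/\ forall x, x < rT -> x != rI -> regs s' x = regs s x,
      regs s' rI = y.+1,
      (forall x, rT <= x -> regs s x = 0) -> forall x, rT <= x -> regs s' x = 0,
      forall a, a < base + 4 * y \/ base + 4 * y.+1 <= a -> mem s' a = mem s a &
      y < b ^ k.+1 -> node_ok (mem s') y].
Proof.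
move=> s'.
have [[[_ _ _ fBase] yE] memE _ best2] := choice_stateP (leqnn k).
have init_regs x : x \notin writes choice_init -> x \notin writes choice_step ->
    regs (choice_state k) x = regs s x.
  move=> xi xs; rewrite /choice_state -run_repeat run_regs ?run_regs //.
  exact: repeat_writes.
have eq_s' : s' = run node_reset (run node_stores (choice_state k)).
  by rewrite /s' /choice_state -run_repeat /node_prog run_seq run_seq run_seq.
clearbody s'.
have mem_s' a : mem s' a = mem (run node_stores (choice_state k)) a.
  by rewrite eq_s' (@run_mem node_reset).
have regs_s' x : x \notin writes node_reset -> regs s' x = regs (choice_state k) x.
  by move=> xr; rewrite eq_s' run_regs // run_regs.
have frame a : a < base + 4 * y \/ base + 4 * y.+1 <= a -> mem s' a = mem s a.
  move=> a_out; rewrite mem_s' run_node_stores fBase yE memE.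
  by do 4?[case: eqP; first by lia].
split=> //.
- move=> x lt_x ne_x; rewrite regs_s' ?init_regs //;
    by case: x lt_x ne_x => [|[|[|[|[|[|[|x]]]]]]].
- by rewrite -[RHS]addn1 -yE eq_s'.
- move=> s0 x le_x; have [in_x|not_x] := boolP (x \in writes node_reset); last first.
    rewrite regs_s' // init_regs ?s0 //; move: le_x not_x; rewrite !inE; lia.
  rewrite eq_s'; move: (run node_stores _) => s2.
  by move: le_x in_x; do 18!(case: x => [|x] //).
move=> lt_y; exists (regs (choice_state k) rBP).
rewrite /node_value !mem_s' !run_node_stores.
rewrite fBase yE; set N := base + 4 * y.
have ne_N c : (N == N + c.+1) = false by lia.
rewrite !ne_N !eqn_add2l !eqxx /=; split=> //.
by apply: best_choice_frame best2 => // a lt_a; apply: frame; left.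
Qed.

End NodeRun.

End Nodes.

(** * Correctness of the program *)

Section Lists.
Variable kd : nat -> nat.

(* [e 0] is the number of areas of type [j] among the first [v], and
   [e 1 < ... < e (e 0)] are these areas. *)
Definition listing (e : nat -> nat) (j v : nat) : Prop :=
  [/\ e 0 = \sum_(u < v) (kd u == j),
      forall r, 0 < r <= e 0 -> e r < v /\ kd (e r) = j,
      forall r r', 0 < r -> r < r' -> r' <= e 0 -> e r < e r' &
      forall r, 0 < r -> e r <= v.-1].

Lemma listing_count_le e j v : listing e j v -> e 0 <= v.
Proof.
move=> [-> _ _ _]; rewrite -[leqRHS]card_ord -sum1_card.
by apply: leq_sum => u _; case: eqP.
Qed.

Lemma listing_same e e' j v : kd v != j -> e =1 e' ->
  listing e j v -> listing e' j v.+1.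
Proof.
move=> ne_j eq_e [e0 e_lt e_mono e_le]; split.
- by rewrite -eq_e e0 big_ord_recr /= (negPf ne_j) addn0.
- by move=> r; rewrite -!eq_e => /e_lt[]; lia.
- by move=> r r'; rewrite -!eq_e; apply: e_mono.
- by move=> r r_gt0; rewrite -eq_e; have := e_le r r_gt0; lia.
Qed.

Lemma listing_add e e' j v : kd v = j ->
    (forall r, e' r = if r == (e 0).+1 then v
                      else if r == 0 then (e 0).+1 else e r) ->
  listing e j v -> listing e' j v.+1.
Proof.
move=> kd_v eq_e [e0 e_lt e_mono e_le].
have e'0 : e' 0 = (e 0).+1 by rewrite eq_e.
have e'_old r : 0 < r <= e 0 -> e' r = e r.
  by move=> lt_r; rewrite eq_e; do 2?[case: eqP; first by lia].
have e'_new : e' (e 0).+1 = v by rewrite eq_e eqxx.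
split.
- by rewrite e'0 e0 big_ord_recr /= kd_v eqxx addn1.
- rewrite e'0 => r /andP[r_gt0]; rewrite leq_eqVlt ltnS.
  move=> /orP[/eqP -> | le_r]; first by rewrite e'_new.
  have lt_r : 0 < r <= e 0 by rewrite r_gt0.
  by rewrite e'_old //; have [] := e_lt r lt_r; lia.
- rewrite e'0 => r r' r_gt0 lt_r; rewrite leq_eqVlt ltnS.
  move=> /orP[/eqP eq_r' | le_r'].
    rewrite eq_r' e'_new e'_old; last by lia.
    by have [] := e_lt r; lia.
  by rewrite !e'_old; [apply: e_mono | lia..].
- move=> r r_gt0; rewrite eq_e; case: eqP => // _; case: eqP; first by lia.
  by move=> _; have := e_le r r_gt0; lia.
Qed.

End Lists.

Lemma run_list_prog s :
  let T := regs s rL + mem s (4 * regs s rI + 1) * regs s rB in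
  [/\ regs (run list_prog s) rI = (regs s rI).+1,
      regs (run list_prog s) rT = 0,
      forall x, x != rI -> x != rT -> regs (run list_prog s) x = regs s x &
      forall a, mem (run list_prog s) a =
        if a == T + (mem s T).+1 then regs s rI
        else if a == T then (mem s T).+1 else mem s a].
Proof.
move=> T; split.
- by rewrite -[RHS]addn1.
- by [].
- by move=> x /negPf ne_I /negPf ne_T; rewrite /= ne_I ne_T.
by move=> a; rewrite -[(mem s T).+1]addn1 /= eqxx.
Qed.

Lemma run_root_steps i s : 
  let s' := iter i (run root_step) s in
  [/\ regs s' rRoot =
        regs s rRoot + \sum_(j < i) mem s (regs s rJ + j * regs s rB) *
                                    (regs s rP * regs s rB ^ j),
      regs s' rJ = regs s rJ + i * regs s rB,
      regs s' rP = regs s rP * regs s rB ^ i,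
      forall x, x != rRoot -> x != rJ -> x != rP -> regs s' x = regs s x &
      mem s' = mem s].
Proof.
elim: i => [|i [IH0 IHJ IHP IHx IHm]] s'.
  by rewrite {}/s' big_ord0 mul0n expn0 muln1 !addn0.
rewrite {}/s' iterS; set s1 := iter i _ s in IH0 IHJ IHP IHx IHm *.
have IHB : regs s1 rB = regs s rB by rewrite IHx.
split.
- by rewrite /= IHJ IHP IHm IH0 big_ord_recr /= addnA.
- by rewrite /= IHJ IHB mulSn; lia.
- by rewrite /= IHP IHB expnSr mulnA.
- by move=> x x0 xJ xP; rewrite -IHx //= (negPf x0) (negPf xJ) (negPf xP).
by [].
Qed.

(** By uniqueness of quotient and remainder, the blocks of [b] cells for distinct types are
    disjoint. *)
Lemma block_eq b j j0 r r0 : r < b -> r0 < b ->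
  (j * b + r == j0 * b + r0) = (j == j0) && (r == r0).
Proof.
move=> lt_r lt_r0; apply/eqP/andP => [eq_j|[/eqP -> /eqP -> //]].
have b_gt0 : 0 < b by lia.
have := congr1 (divn^~ b) eq_j; have := congr1 (modn^~ b) eq_j.
by rewrite !modnMDl !divnMDl // !divn_small // !modn_small // !addn0 => -> ->.
Qed.

(** * Invariants of the two loops and running time *)

Section Correctness.
Variables (k n N : nat) (inp : seq nat).
Let kd v := nth 0 inp (4 * v + 1).
Hypothesis inp_n : nth 0 inp 0 = n.
Hypothesis kd_lt : forall v, v < n -> kd v < k.
Hypothesis size_inp : 4 * n + 1 <= N.
Hypothesis inp_lt : forall a, nth 0 inp a < 2 ^ N.

Notation b := (2 * n + 1).
Notation L := (4 * n + 1).
Notation base := (L + k * b).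

(** [N] stands for the input size. Addresses need at most [k + 5 + N * k.+1] bits, by [base_bound],
    and scaled values at most [N + N.+1 * (k * N)], by [value_bound]; one bound covers both. *)
Definition bit_bound : nat := N * N * (2 * k + 6).
Notation B := bit_bound.

Definition lists_inv (v : nat) (s : state) : Prop :=
  [/\ [/\ regs s rN = n, regs s rB = b, regs s rL = L, regs s rI = v &
          forall x, x \notin [:: rN; rB; rL; rI] -> regs s x = 0],
      forall a, a < L -> mem s a = nth 0 inp a,
      forall j, j < k -> exists2 e, listing kd e j v &
        forall r, r < b -> mem s (L + j * b + r) = e r &
      forall a, mem s a < 2 ^ N].

Lemma area_count_lt : n < 2 ^ N.
Proof. by apply: leq_trans (ltn_expl N (isT : 1 < 2)); lia. Qed.

Lemma lists_inv_step v s :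
  lists_inv v s -> v < n -> lists_inv v.+1 (run list_prog s).
Proof.
move=> [[sN sB sL sI s0] s_inp s_list s_lt] lt_v.
have [uI uT ux um] := run_list_prog s; rewrite sI sL sB in uI ux um.
have kd_v : mem s (4 * v + 1) = kd v by apply: s_inp; lia.
rewrite kd_v in um; set T := L + kd v * b in um.
have [e e_list e_mem] := s_list _ (kd_lt lt_v).
have T_mem : mem s T = e 0 by rewrite -e_mem ?addn0 // addn1.
have e0_le := listing_count_le e_list.
rewrite T_mem in um; split.
- split=> //; rewrite ?ux // => x; have [-> //|ne_T] := eqVneq x rT.
  by rewrite !inE => x_out; rewrite ux ?s0 // ?inE //; move: x_out; lia.
- move=> a lt_a; rewrite um; do 2?[case: eqP; first by lia].
  by move=> *; apply: s_inp.
(* At most [v < n] areas are listed so far, so the new entry stays inside its block of [b] cells. *)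
- move=> j lt_j; have lt_e0 : (e 0).+1 < b by lia.
  have b_gt0 : 0 < b by lia.
  have um' r : r < b -> mem (run list_prog s) (L + j * b + r) =
      if (j == kd v) && (r == (e 0).+1) then v
      else if (j == kd v) && (r == 0) then (e 0).+1 else mem s (L + j * b + r).
    move=> lt_r; rewrite um.
    have eq_T c : c < b -> (L + j * b + r == T + c) = (j == kd v) && (r == c).
      by move=> lt_c; rewrite -!(addnA L) eqn_add2l block_eq.
    by rewrite eq_T // -[T]addn0 eq_T.
  have [j_v|ne_j] := eqVneq j (kd v).
    exists (fun r => if r == (e 0).+1 then v else if r == 0 then (e 0).+1 else e r).
      by rewrite j_v; apply: listing_add e_list.
    by move=> r lt_r; rewrite um' // j_v eqxx /= e_mem //.
  have [ej ej_list ej_mem] := s_list _ lt_j; exists ej.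
    by apply: listing_same ej_list => //; rewrite eq_sym.
  by move=> r lt_r; rewrite um' // (negPf ne_j) ej_mem //.
- have lt_n := area_count_lt.
  move=> a; rewrite um; do 2?[case: ifP => _]; [lia|lia|].
  exact: s_lt.
Qed.


Lemma word_bound_gt0 : 0 < N.
Proof. by lia. Qed.

Lemma bit_bound_ge : N <= B.
Proof. by rewrite /bit_bound; have := word_bound_gt0; nia. Qed.

Lemma bit_bound_gt0 : 0 < B.
Proof. exact: leq_trans word_bound_gt0 bit_bound_ge. Qed.

Lemma leq_lt_bit_bound a : a <= N -> a < 2 ^ B.
Proof.
move=> le_a; apply: leq_ltn_trans (leq_trans le_a bit_bound_ge) _.
exact: ltn_expl.
Qed.

Lemma pow_lt_bit_bound a : a < 2 ^ N -> a < 2 ^ B.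
Proof.
by move=> lt_a; apply: leq_trans lt_a _; rewrite leq_exp2l // bit_bound_ge.
Qed.

Lemma lists_inv_bounded v s : v <= n -> lists_inv v s -> bounded B s.
Proof.
move=> le_v [[sN sB sL sI s0] _ _ s_lt]; split=> x; last exact: pow_lt_bit_bound.
have [|x_out] := boolP (x \in [:: rN; rB; rL; rI]); last by rewrite s0 // expn_gt0.
rewrite !inE => /or4P[] /eqP ->; rewrite ?sN ?sB ?sL ?sI;
  by apply: leq_lt_bit_bound; lia.
Qed.

Lemma init_bounded : bounded B (init inp).
Proof. by split=> x; [rewrite /= expn_gt0 | apply/pow_lt_bit_bound/inp_lt]. Qed.

Hypothesis inp_end : forall a, L <= a -> nth 0 inp a = 0.

Lemma lists_inv0 : lists_inv 0 (run setup_prog (init inp)).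
Proof.
split=> //=.
- split=> //=; rewrite ?inp_n // => x.
  by rewrite !inE; case: x => [|[|[|[|[|[|x]]]]]].
- move=> j lt_j; exists (fun=> 0) => [|r lt_r]; last by rewrite inp_end //; lia.
  by split=> //; [rewrite big_ord0 | move=> r; lia..].
Qed.

Definition root_node (M : nat -> nat) : nat :=
  n + \sum_(j < k) M (L + j * b) * b ^ j.+1.

Lemma base_bound : base + 4 * b ^ k.+1 < 2 ^ B.
Proof.
have b_le : b <= N by lia.
have pow_le : b ^ k.+1 <= N ^ k.+1 by rewrite leq_exp2r.
have N1 : N <= N ^ k.+1 by rewrite expnS leq_pmulr // expn_gt0 word_bound_gt0.
apply: leq_ltn_trans (_ : (k + 5) * N ^ k.+1 < _); first by nia.
have lt1 : k + 5 < 2 ^ (k + 5) by apply: ltn_expl.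
have lt2 : N ^ k.+1 <= 2 ^ (N * k.+1).
  by rewrite expnM leq_exp2r //; apply/ltnW/ltn_expl.
apply: leq_trans (_ : 2 ^ (k + 5) * 2 ^ (N * k.+1) <= _).
  have := expn_gt0 2 (N * k.+1); nia.
rewrite -expnD leq_exp2l // /B; have := word_bound_gt0; nia.
Qed.

Definition diagram_inv (M1 : nat -> nat) (y : nat) (s : state) : Prop :=
  [/\ fixed_regs k n s, regs s rI = y, 
      regs s rRoot = base + 4 * root_node M1 /\ regs s rM = b ^ k.+1,
      forall x, rT <= x -> regs s x = 0 &
      [/\ forall a, a < base -> mem s a = M1 a,
          forall z, z < y -> node_ok k n M1 (mem s) z &
          forall a, mem s a < 2 ^ B]].

Lemma root_node_lt s : lists_inv n s -> root_node (mem s) < b ^ k.+1.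
Proof.
move=> [_ _ s_list _]; pose f j := if j is i.+1 then mem s (L + i * b) else n.
have -> : root_node (mem s) = from_digits b k.+1 f.
  rewrite /root_node /from_digits big_ord_recl expn0 muln1; congr addn.
apply: from_digits_lt => [|[|j]] /=; [lia | lia |].
rewrite ltnS => lt_j; have [e e_list e_mem] := s_list _ lt_j.
by have := listing_count_le e_list; rewrite -e_mem ?addn0; lia.
Qed.

Lemma diagram_inv0 s :
  lists_inv n s -> diagram_inv (mem s) 0 (run (root_prog k) s).
Proof.
move=> s_inv; have root_lt := root_node_lt s_inv; move: s_inv.
move=> [[sN sB sL sI s0] _ _ s_lt].
pose s1 := run (rP ::= $rB)%P (run (rJ ::= $rL)%P (run (rRoot ::= $rN)%P s)).
have [] := run_root_steps k s1; rewrite -run_repeat.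
have -> : run (root_prog k) s = run (
    rBase ::= $rJ ;; rM ::= $rP ;; rRoot ::= $rBase + #4 * $rRoot ;;
    rI ::= #0 ;; rJ ::= #0 ;; rP ::= #0)%P (run (repeat k root_step) s1).
  by rewrite /root_prog 4!run_seq.
move: (run (repeat k root_step) s1) => s2 /=.
rewrite sN sB sL => r0 rJ' rP' rx rmem.
split.
- by split; rewrite /= ?rJ' // rx.
- by [].
- split; last by rewrite /= rP' -expnS.
  rewrite /= rJ' r0 /root_node; congr (_ + 4 * (_ + _)).
  by apply: eq_bigr => j _; rewrite expnS.
- move=> x lt_x; case: (boolP (x \in [:: rJ; rP])).
    by rewrite !inE => /orP[] /eqP ->.
  rewrite !inE => /norP[/negPf nJ /negPf nP].
  have [n0 nI nB nM] : [/\ (x == 0) = false, (x == rI) = false,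
     (x == rBase) = false & (x == rM) = false] by split; lia.
  rewrite /= n0 nI nB nM nJ nP rx ?nJ ?nP ?n0 //= ?nJ ?nP ?n0 s0 // !inE; lia.
split=> [a _ | // | a] /=; first by rewrite rmem.
by rewrite rmem; apply: pow_lt_bit_bound.
Qed.

Section Loop.
Variable M1 : nat -> nat.
Hypothesis M1_lt : forall a, M1 a < 2 ^ N.
Hypothesis entry_le :
  forall j r, j < k -> 0 < r < b -> entry n M1 j r <= n.-1.
Hypothesis root_lt : root_node M1 < b ^ k.+1.

Lemma value_bound M y : y < b ^ k.+1 ->
  (forall z, z <= y -> node_ok k n M1 M z) -> node_value k n M y < 2 ^ B.
Proof.
move=> lt_y ok; have Q_gt0 : 0 < 2 ^ N by rewrite expn_gt0.
apply: leq_ltn_trans (@node_value_le k n M1 M y.+1 (2 ^ N) Q_gt0 _ _ _ _ y _) _ => //.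
  by move=> a _; apply: ltnW.
(* An arbitrary node may have digits up to [2 * n], so the digit sum is bounded through the base and
   not by [n]. *)
have sum_le : digit_sum k n y <= k * N.
  rewrite -[k in k * N]card_ord -sum_nat_const; apply: leq_sum => j _.
  by have := @digit_lt b _ y j.+1; rewrite addn1 => /(_ isT); lia.
have lt1 : 2 * n < 2 ^ N by apply: leq_ltn_trans (ltn_expl N (isT : 1 < 2)); lia.
have lt2 : (2 * 2 ^ N) ^ digit_sum k n y <= 2 ^ (N.+1 * (k * N)).
  by rewrite -expnS -expnM leq_exp2l // leq_mul2l sum_le orbT.
apply: leq_trans (_ : 2 ^ N * 2 ^ (N.+1 * (k * N)) <= _).
  have := expn_gt0 2 (N.+1 * (k * N)); nia.
rewrite -expnD leq_exp2l // /bit_bound; have := word_bound_gt0; nia.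
Qed.

Lemma diagram_inv_step y s :
    diagram_inv M1 y s -> y < b ^ k.+1 ->
  diagram_inv M1 y.+1 (run (node_prog k) s).
Proof.
move=> [s_fixed s_I [s_root s_M] s0 [s_mem s_ok s_lt]] lt_y.
have [ux uI u0 frame ok_y] := run_node_prog s_fixed s_I s_mem entry_le.
have {}ok_y := ok_y lt_y; have [sN sB sL sBase] := s_fixed.
move: (run (node_prog k) s) ux uI u0 frame ok_y => s' ux uI u0 frame ok_y.
have s'_ok z : z <= y -> node_ok k n M1 (mem s') z.
  rewrite leq_eqVlt => /orP[/eqP -> //|lt_z].
  apply: node_ok_frame (s_ok z lt_z); first by apply: ltn_trans lt_y.
  by move=> a lt_a; apply: frame; left; lia.
split=> //.
- by split; rewrite ux.
- by rewrite !ux.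
- exact: u0.
split=> //; first by move=> a lt_a; rewrite frame ?s_mem //; left; lia.
have small c : c < 2 ^ N -> c < 2 ^ B by exact: pow_lt_bit_bound.
move=> a; have [lt_a|ge_a] := ltnP a (base + 4 * y); first by rewrite frame //; left.
have [ge_a'|lt_a'] := leqP (base + 4 * y.+1) a; first by rewrite frame //; right.
have value_lt := value_bound lt_y s'_ok.
have [p [best1 acc rej]] := ok_y.
have child_lt d : base + 4 * child y p d < 2 ^ B.
  by apply: leq_ltn_trans base_bound; rewrite /child; case: d; lia.
have [] : [\/ a = base + 4 * y, a = base + 4 * y + 1, a = base + 4 * y + 2
            | a = base + 4 * y + 3].
  have : a - (base + 4 * y) < 4 by lia.
  case E: (a - _) => [|[|[|[|c]]]] // _;
    by [apply: Or41; lia | apply: Or42; lia | apply: Or43; lia | apply: Or44; lia].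
- move=> ->; case: best1 => [[_ _ -> _]|[j [[lt_j av_j] _ -> _ _]]].
    by rewrite expn_gt0.
  exact: small (M1_lt _).
- by move=> ->; rewrite acc.
- by move=> ->; rewrite rej.
by move=> ->.
Qed.

Lemma diagram_inv_bounded y s : y <= b ^ k.+1 -> diagram_inv M1 y s -> bounded B s.
Proof.
move=> le_y [[sN sB sL sBase] s_I [s_root s_M] s0 [_ _ s_lt]]; split=> // x.
have le_pow : b ^ k.+1 < 2 ^ B by apply: leq_ltn_trans base_bound; lia.
have [/s0 ->|lt_x] := leqP rT x; first by rewrite expn_gt0.
case: x lt_x => [|[|[|[|[|[|[|x]]]]]]] // _;
  rewrite ?s_root ?sN ?sB ?sL ?sBase ?s_I ?s_M.
all: try by apply: leq_lt_bit_bound; lia.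
- by apply: leq_ltn_trans base_bound; lia.
- by apply: leq_ltn_trans base_bound; lia.
- exact: leq_ltn_trans le_pow.
- exact: le_pow.
Qed.

End Loop.

(** It depends on [k] alone. The factor 2 absorbs the final, failing test of the main loop, and
    [2 * k + 6] comes from [bit_bound]. *)
Definition cost_factor : nat :=
  (pcost setup_prog + (ecost ($rI < $rN)%P + pcost list_prog) + pcost (root_prog k) +
   2 * (ecost ($rI < $rM)%P + pcost (node_prog k))) * (2 * k + 6).

Lemma diagram_prog_correct : exists s t M1,
  [/\ exec (diagram_prog k) (init inp) s t,
      t <= cost_factor * N ^ (k + 3),
      [/\ forall a, a < L -> M1 a = nth 0 inp a &
          forall j, j < k -> exists2 e, listing kd e j n &
            forall r, r < b -> entry n M1 j r = e r],
      regs s rRoot = base + 4 * root_node M1 &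
      forall z, z < b ^ k.+1 -> node_ok k n M1 (mem s) z].
Proof.
have [_ [t1 ex1 le1]] := @exec_run setup_prog B _ isT bit_bound_gt0 init_bounded.
have [s2 [t2 [ex2 inv2 le2]]] : exists s' t,
    [/\ exec (While ($rI < $rN)%P list_prog) (run setup_prog (init inp)) s' t,
        lists_inv n s' &
        t <= n.+1 * ((ecost ($rI < $rN)%P + pcost list_prog) * B)].
  apply: (exec_while (Inv := lists_inv)) lists_inv0 => //.
  - exact: bit_bound_gt0.
  - by move=> i s inv le_i; apply: lists_inv_bounded inv.
  - by move=> i s [[sN _ _ sI _] _ _ _] _ /=; rewrite sN sI eqb0 negbK.
  - exact: lists_inv_step.
have root_free : loop_free (root_prog k) by rewrite /= repeat_loop_free.
have node_free : loop_free (node_prog k) by rewrite /= repeat_loop_free.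
have [_ [t3 ex3 le3]] :=
  exec_run root_free bit_bound_gt0 (lists_inv_bounded (leqnn n) inv2).
have [M1_regs M1_inp M1_list M1_lt] := inv2.
have M1_entry j r : j < k -> 0 < r < b -> entry n (mem s2) j r <= n.-1.
  move=> lt_j /andP[r_gt0 lt_r]; have [e [_ _ _ e_le] e_mem] := M1_list j lt_j.
  by rewrite /entry e_mem // e_le.
have root_lt := root_node_lt inv2.
have [s4 [t4 [ex4 inv4 le4]]] : exists s' t,
    [/\ exec (While ($rI < $rM)%P (node_prog k)) (run (root_prog k) s2) s' t,
        diagram_inv (mem s2) (b ^ k.+1) s' &
        t <= (b ^ k.+1).+1 * ((ecost ($rI < $rM)%P + pcost (node_prog k)) * B)].
  apply: (exec_while (Inv := diagram_inv (mem s2))) (diagram_inv0 inv2) => //.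
  - exact: bit_bound_gt0.
  - by move=> i s inv le_i; apply: diagram_inv_bounded inv.
  - by move=> i s [_ sI [_ sM] _ _] _ /=; rewrite sI sM eqb0 negbK.
  - by move=> i s inv lt_i; apply: diagram_inv_step.
have [_ _ [root4 _] _ [_ ok4 _]] := inv4.
exists s4, (t1 + (t2 + (t3 + t4))), (mem s2); split=> //.
  by do 3![apply: ExecSeq; first by eassumption].
rewrite /cost_factor; set c1 := pcost setup_prog in le1 *.
set c2 := ecost _ + _ in le2 *; set c3 := pcost _ in le3 *.
set c4 := ecost _ + _ in le4 *; set T := N ^ k.+1.
have N0 := word_bound_gt0.
have T_gt0 : 0 < T by rewrite expn_gt0 N0.
have N_T : N <= T by rewrite /T expnS leq_pmulr // expn_gt0 N0.
have b_T : b ^ k.+1 <= T by rewrite leq_exp2r //; lia.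
(* The exponent: [T = N ^ k.+1] bounds the number of rounds, and [N * N] is the bit length up to a
   constant factor. *)
have -> : N ^ (k + 3) = T * (N * N) by rewrite /T !addnS addn0 !expnS; ring.
have BE : B = (2 * k + 6) * (N * N) by rewrite mulnC.
apply: leq_trans (_ : (c1 + c2 + c3 + 2 * c4) * T * B <= _); last first.
  by rewrite BE; apply: eq_leq; ring.
have u1 : c1 * B <= c1 * T * B by rewrite leq_mul2r leq_pmulr ?orbT.
have u3 : c3 * B <= c3 * T * B by rewrite leq_mul2r leq_pmulr ?orbT.
have u2 : n.+1 * (c2 * B) <= T * (c2 * B) by rewrite leq_mul2r; apply/orP; right; lia.
have u4 : (b ^ k.+1).+1 * (c4 * B) <= (2 * T) * (c4 * B).
  by rewrite leq_mul2r; apply/orP; right; lia.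
have -> : (c1 + c2 + c3 + 2 * c4) * T * B =
  c1 * T * B + (T * (c2 * B) + (c3 * T * B + 2 * T * (c4 * B))) by ring.
apply: leq_add; first exact: leq_trans u1.
apply: leq_add; first exact: leq_trans u2.
by apply: leq_add; [exact: leq_trans u3 | exact: leq_trans u4].
Qed.

End Correctness.

(** * From memory contents to strategies *)

Section Encoding.
Variables (k n : nat) (S : society k n).

Definition area_record (v : 'I_n) : seq nat :=
  [:: val (kind S v); threshold S v;
      absz (numq (prob S v)); absz (denq (prob S v))].

Lemma nth_flatten_records (T : eqType) (f : T -> seq nat) (s : seq T) i c v0 :
  (forall v, size (f v) = 4) -> i < size s -> c < 4 ->
  nth 0 (flatten [seq f v | v <- s]) (4 * i + c) = nth 0 (f (nth v0 s i)) c.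
Proof.
move=> sz_f; elim: s i => [|v s IHs] [|i] //= lt_i lt_c.
  by rewrite muln0 add0n nth_cat sz_f lt_c.
rewrite nth_cat sz_f mulnS -addnA ltnNge leq_addr /= addKn.
exact: IHs.
Qed.

Lemma nth_encode (v : 'I_n) c : c < 4 ->
  nth 0 (encode S) (4 * v + c.+1) = nth 0 (area_record v) c.
Proof.
move=> lt_c; rewrite addnS /= (nth_flatten_records v) //.
  by rewrite nth_ord_enum.
by rewrite size_enum_ord.
Qed.

Lemma size_encode : size (encode S) = 4 * n + 1.
Proof.
rewrite /= size_flatten /shape -map_comp addn1; congr _.+1.
rewrite (eq_map (g := fun=> 4)) // sumnE big_map big_const_seq count_predT.
by rewrite size_enum_ord iter_addn_0.
Qed.

Lemma size_encode_le : 4 * n + 1 <= input_size (encode S).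
Proof.
rewrite -size_encode -sum1_size /input_size.
by apply: leq_sum => x _; rewrite /bits.
Qed.

Lemma nth_encode_lt a : nth 0 (encode S) a < 2 ^ input_size (encode S).
Proof.
have [lt_a|ge_a] := ltnP a (size (encode S)); last first.
  by rewrite nth_default // expn_gt0.
apply: leq_trans (ltn_exp_bits _) _; rewrite leq_exp2l //.
rewrite /input_size (big_rem (nth 0 (encode S) a)) ?leq_addr //.
exact: mem_nth.
Qed.

End Encoding.

Section Kinds.
Variables (k n : nat) (S : society k n).

Definition kind_of (v : nat) : nat := nth 0 (encode S) (4 * v + 1).

Lemma kind_ofE (v : 'I_n) : kind_of v = kind S v.
Proof. by rewrite /kind_of (@nth_encode k n S v 0). Qed.

End Kinds.

(** * The strategy read off the diagram and its optimality *)

Section Main.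
Variables (k n' : nat) (S : society k n'.+1).
Notation n := n'.+1.
Notation b := (2 * n + 1).
Notation L := (4 * n + 1).
Notation base := (L + k * b).

Variables (s : state) (M1 : nat -> nat).
Hypothesis M1_inp : forall a, a < L -> M1 a = nth 0 (encode S) a.
Hypothesis M1_list : forall j, j < k -> exists2 e, listing (kind_of S) e j n &
  forall r, r < b -> entry n M1 j r = e r.
Hypothesis s_root : regs s 0 = base + 4 * root_node k n M1.
Hypothesis s_ok : forall z, z < b ^ k.+1 -> node_ok k n M1 (mem s) z.

Lemma type_size_le (j : 'I_k) : type_size S j <= n.
Proof. by rewrite -[leqRHS]card_ord; apply: max_card. Qed.

Lemma entry0 (j : 'I_k) : entry n M1 j 0 = type_size S j.
Proof.
have [e [e0 _ _ _] e_mem] := M1_list (ltn_ord j).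
rewrite e_mem ?addn1 // e0 /type_size -sum1_card [RHS]big_mkcond.
by apply: eq_bigr => u _; rewrite kind_ofE inE -val_eqE.
Qed.

Lemma entryP (j : 'I_k) r : 0 < r <= type_size S j ->
  exists2 u : 'I_n, entry n M1 j r = u & kind S u = j.
Proof.
rewrite -entry0 => r_j; have le_n := type_size_le j.
have [e [_ e_lt _ _] e_mem] := M1_list (ltn_ord j).
rewrite -entry0 in le_n; have lt_r : r < b by lia.
rewrite (e_mem r lt_r); rewrite e_mem in r_j; last by lia.
have [lt_e kind_e] := e_lt r r_j.
by exists (Ordinal lt_e) => //; apply: val_inj; rewrite /= -kind_ofE.
Qed.

Lemma entry_inj (j : 'I_k) r r' : 0 < r <= type_size S j ->
  0 < r' <= type_size S j -> entry n M1 j r = entry n M1 j r' -> r = r'.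
Proof.
have le_n := type_size_le j; rewrite -entry0 in le_n *.
have [e [_ _ e_mono _] e_mem] := M1_list (ltn_ord j).
rewrite e_mem in le_n *; [|lia..].
move=> /andP[r0 le_r] /andP[r'0 le_r']; rewrite !e_mem; [|lia..].
by have [lt_r|lt_r|//] := ltngtP r r';
  [have := e_mono r r' r0 lt_r le_r' | have := e_mono r' r r'0 lt_r le_r]; lia.
Qed.

Lemma entry_data (j : 'I_k) r (u : 'I_n) x : entry n M1 j r = u ->
  let v := entry n M1 j r in
  scaled n x (M1 (4 * v + 2)) (M1 (4 * v + 3)) (M1 (4 * v + 4)) =
  scaled_prob S u x /\ M1 (4 * v + 4) = area_den S u.
Proof.
move=> -> v; rewrite {}/v !M1_inp; [|by have := ltn_ord u; lia..].
by rewrite (@nth_encode k n S u 1) // (@nth_encode k n S u 2) //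
           (@nth_encode k n S u 3).
Qed.

(** [insub] extends [m] by 0 to all natural numbers, as [from_digits] requires. *)
Definition code (m : 'I_k -> nat) (x : nat) : nat :=
  from_digits b k.+1 (fun i =>
    if i is j.+1 then oapp m 0 (insub j) else x).

Lemma eq_code m m' x : m =1 m' -> code m x = code m' x.
Proof.
move=> eq_m; apply: eq_from_digits => -[|j] _ //.
by case: insub => //= j'; apply: eq_m.
Qed.

Section Code.
Variables (m : 'I_k -> nat) (x : nat).
Hypothesis (m_le : forall j, m j <= type_size S j) (x_le : x <= 2 * n).

Let code_digit_lt i : i < k.+1 ->
  (if i is j.+1 then oapp m 0 (insub j) else x) < b.
Proof.
case: i => [|j] _; first by lia.
case: insub => [j'|] /=; last by lia.
by have := m_le j'; have := type_size_le j'; lia.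
Qed.

Lemma code_lt : code m x < b ^ k.+1.
Proof. by apply: from_digits_lt; [lia | exact: code_digit_lt]. Qed.

Lemma code_digit0 : digit b (code m x) 0 = x.
Proof. by rewrite digit_from. Qed.

Lemma code_digit (j : 'I_k) : digit b (code m x) j.+1 = m j.
Proof.
by rewrite digit_from ?valK // ltnS.
Qed.

Lemma code_available (j : 'I_k) :
  available n (code m x) j = (0 < m j) && (0 < x < 2 * n).
Proof. by rewrite /available code_digit code_digit0. Qed.

Lemma code_child (j : 'I_k) d : 0 < m j -> 0 < x < 2 * n ->
  child (code m x) (b ^ j.+1) d = code (decr m j) (if d then x.+1 else x.-1).
Proof.
move=> m_gt0 /andP[x_gt0 x_lt].
have b_gt0 : 0 < b by lia.
have dj_gt0 : 0 < digit b (code m x) j.+1 by rewrite code_digit.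
have d0_gt0 : 0 < digit b (code m x) 0 by rewrite code_digit0.
have d0_lt : (digit b (code m x) 0).+1 < b by rewrite code_digit0; lia.
have [_ lt_c c0 c_dig] :=
  child_digits b_gt0 d (ltn_ord j) code_lt dj_gt0 d0_gt0 d0_lt.
rewrite /child -(from_digits_digit b_gt0 lt_c); apply: eq_from_digits.
case=> [|i] lt_i; first by rewrite c0 code_digit0.
rewrite ltnS in lt_i; rewrite c_dig // insubT /=.
by rewrite (code_digit (Ordinal lt_i)).
Qed.

End Code.

Definition code_value (m : 'I_k -> nat) (x : nat) : nat :=
  node_value k n (mem s) (code m x).

(** The program evaluates a type through one listed area; any other area of the type has the same
    threshold and probability, hence the same candidate value. *)
Lemma candidate_code (m : 'I_k -> nat) x (j : 'I_k) (u : 'I_n) :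
    (forall i, m i <= type_size S i) -> 0 < x < 2 * n -> 0 < m j ->
    kind S u = j ->
  candidate_value k n M1 (mem s) (code m x) j = candidate S code_value u m x.
Proof.
move=> m_le x_in m_gt0 kind_u; have x_le : x <= 2 * n by lia.
have [|w entry_w kind_w] := @entryP j (m j); first by rewrite m_gt0 m_le.
have [data den_w] := entry_data x entry_w.
rewrite /candidate_value !code_child // code_digit // code_digit0 //.
rewrite data den_w /candidate -kind_u in kind_w *.
by rewrite (scaled_prob_kind _ kind_w) -!type_den_kind kind_w kind_u.
Qed.

Lemma code_value_function : value_function S code_value.
Proof.
split=> [m m' x eq_m|m x m0 x_le|m x v m_le x_in m_gt0].
- by rewrite /code_value (eq_code _ eq_m).
- have m_le j : m j <= type_size S j by rewrite m0.
  have [p [best1 _ _]] := s_ok (code_lt m_le x_le).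
  case: best1 => [[_ w0 _ _]|[j [[lt_j]]]].
    by rewrite /code_value w0 code_digit0.
  by rewrite (code_available m_le x_le (Ordinal lt_j)) m0.
have x_le : x <= 2 * n by lia.
have av_v : available n (code m x) (kind S v).
  by rewrite code_available // m_gt0 x_in.
rewrite -(candidate_code m_le x_in m_gt0 (erefl _)).
have [p [best1 _ _]] := s_ok (code_lt m_le x_le).
case: best1 => [[_ _ _ /(_ (kind S v) (ltn_ord _))]|[j [_ _ _ _]]].
  by rewrite av_v.
exact.
Qed.

(** A cell may hold any number, so [insubd] supplies a default; by [at_code_step] it is not reached
    at histories shorter than [n]. *)
Definition output_strategy : strategy n :=
  fun i h => insubd i (mem s (node_after s h)).
Notation sigma := output_strategy.

(** Following the links along [h] leads to the node of the situation after [h]. The sum is carried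
    along because [sum_remaining] presupposes [schedulable], which is itself derived from this
    invariant. *)
Definition at_code (h : seq bool) : Prop :=
  \sum_j remaining S sigma h j + size h = n /\
  node_after s h = base + 4 * code (remaining S sigma h) (level n' h).

Lemma at_code_step h : size h < n -> at_code h ->
  let v := next_area sigma h in
  [/\ 0 < remaining S sigma h (kind S v),
      entry n M1 (kind S v) (remaining S sigma h (kind S v)) = v,
      code_value (remaining S sigma h) (level n' h) =
        candidate S code_value v (remaining S sigma h) (level n' h),
      mem s (node_after s h) = v &
      forall d, at_code (rcons h d)].
Proof.
move=> lt_h [sum_h node_h] v; set m := remaining S sigma h in sum_h node_h *.
set x := level n' h in node_h *; have x_in : 0 < x < 2 * n := level_bounds lt_h.
have x_le : x <= 2 * n by lia.
have m_le j : m j <= type_size S j := remaining_le S sigma h j.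
have [p [best1 acc rej]] := s_ok (code_lt m_le x_le).
case: best1 => [[_ _ _ none]|[j0 [[lt_j0 av_j] pE aE wE _]]].
  (* Fewer than [n] areas are scheduled, so some type has areas left; with [0 < x < 2 * n] it is
     available. *)
  suff : \sum_j m j = 0 by lia.
  apply: big1 => j _; have := none j (ltn_ord j).
  by rewrite code_available // x_in andbT; case: (m j).
pose j := Ordinal lt_j0; rewrite -[j0]/(val j) in av_j pE aE wE.
rewrite code_available // x_in andbT in av_j.
rewrite code_digit // in aE.
have [|u entry_u kind_u] := @entryP j (m j); first by rewrite av_j m_le.
have mem_u : mem s (node_after s h) = u by rewrite node_h aE entry_u.
have v_u : v = u.
  apply: val_inj; rewrite /v /next_area /output_strategy.
  by rewrite val_insubd mem_u ltn_ord.
rewrite v_u kind_u; split=> //.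
  by rewrite -(candidate_code m_le x_in av_j kind_u).
move=> d; have eq_m : remaining S sigma (rcons h d) =1 decr m j.
  by move=> i; rewrite remaining_rcons -/v v_u kind_u.
split.
  rewrite size_rcons addnS -sum_h -(decr_sum av_j) addSn; congr (_ + _).+1.
  exact: eq_bigr.
rewrite (eq_code _ eq_m) level_rcons // -/x /node_after foldl_rcons.
rewrite -/(node_after s h) node_h -(code_child m_le x_le) //.
by case: (d); rewrite ?acc ?rej pE.
Qed.

Lemma at_codeP h : size h <= n -> at_code h.
Proof.
elim/last_ind: h => [_|h d IHh].
  have eq_m : remaining S sigma [::] =1 type_size S.
    by move=> j; rewrite /remaining subn0.
  split.
    rewrite addn0 -[RHS](sum_type_size S).
    exact: eq_bigr.
  rewrite (eq_code _ eq_m) /node_after /= s_root /root_node /code /from_digits.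
  rewrite big_ord_recl expn0 muln1 /level /= muln0 add0n subn0.
  congr (_ + 4 * (_ + _)); apply: eq_bigr => j _.
  by rewrite valK /= -entry0 /entry addn0.
rewrite size_rcons => lt_h.
by have [_ _ _ _] := at_code_step lt_h (IHh (ltnW lt_h)).
Qed.

Lemma output_strategy_outputs : outputs s sigma.
Proof.
move=> i h sz_h; have lt_h : size h < n by rewrite sz_h.
have [_ _ _ mem_v _] := at_code_step lt_h (at_codeP (ltnW lt_h)).
by rewrite /output_strategy val_insubd mem_v ltn_ord.
Qed.

Lemma output_strategy_best : best S sigma.
Proof.
have sigma_ok : schedulable S sigma.
  by move=> h lt_h; have [] := at_code_step lt_h (at_codeP (ltnW lt_h)).
apply: (greedy_best code_value_function _ sigma_ok).
  apply: (listed_valid (e := entry n M1) _ sigma_ok).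
    exact: entry_inj.
  by move=> h lt_h v; have [] := at_code_step lt_h (at_codeP (ltnW lt_h)).
by move=> h lt_h; have [] := at_code_step lt_h (at_codeP (ltnW lt_h)).
Qed.

End Main.

Theorem theorem6 (k : nat) :
  exists (P : program) (a d : nat),
    forall (n : nat) (S : society k n),
    exists (s : state) (t : nat) (sigma : strategy n),
      [/\ exec P (init (encode S)) s t,
          (t <= a * input_size (encode S) ^ d)%N,
          outputs s sigma
        & best S sigma].
Proof.
exists (diagram_prog k), (cost_factor k), (k + 3) => n S.
have kind_lt v : v < n -> kind_of S v < k.
  by move=> lt_v; rewrite (kind_ofE S (Ordinal lt_v)).
have inp_end a : 4 * n + 1 <= a -> nth 0 (encode S) a = 0.
  by move=> le_a; rewrite nth_default // size_encode.
have [s [t [M1 [ex_s le_t [M1_inp M1_list] s_root s_ok]]]] :=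
  @diagram_prog_correct k n _ (encode S) (erefl _) kind_lt (size_encode_le S)
     (nth_encode_lt S) inp_end.
case: n => [|n'] in S kind_lt inp_end le_t M1_inp M1_list s_root s_ok ex_s *.
  by exists s, t, (fun i _ => i); split=> //; [case | exact: no_area_best].
exists s, t, (@output_strategy n' s); split=> //.
  exact: output_strategy_outputs M1_inp M1_list s_root s_ok.
exact: output_strategy_best M1_inp M1_list s_root s_ok.
Qed.
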